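(* Let $(X,w,\mu)$ be a locally finite weighted graph and let $d=d_\sigma$ be a strongly intrinsic path metric. Suppose that $(X,d)$ is not metrically complete and that $\mathrm{Cap}(\partial_CX)<\infty$. Then the Cauchy boundary $\partial_CX$ is polar if and only if $$D(Q)=D(Q^{\max}),$$ that is, if and only if $L_c=\Delta|_{C_c(X)}$ has a unique Markovian extension.
   Context: All functions are real valued. A weighted graph $(X,w,\mu)$ consists of a countably infinite discrete set $X$, a function $\mu:X\to(0,\infty)$ (viewed as a measure on $X$), and a symmetric function $w:X\times X\to[0,\infty)$ with $w(x,x)=0$ and $\sum_{y\in X}w(x,y)<\infty$ for all $x\in X$. Write $x\sim y$ ($x,y$ are neighbors) if $w(x,y)>0$. The graph is locally finite if every vertex has only finitely many neighbors. A path connecting $x$ and $y$ is a sequence $(x_0,\dots,x_n)$, $n\ge1$, with $x_0=x$, $x_n=y$, $x_i\sim x_{i+1}$. All weighted graphs are assumed connected: any two distinct points are connected by a path. Let $\sigma:X\times X\to[0,\infty)$ be symmetric with $\sigma(x,y)>0$ if and only if $x\sim y$. The path pseudo metric $d_\sigma$ is given by $d_\sigma(x,x)=0$ and, for $x\ne y$, $d_\sigma(x,y)=\inf l_\sigma((x_0,\dots,x_n))$ over all paths connecting $x$ and $y$, where $l_\sigma((x_0,\dots,x_n))=\sum_{i=0}^{n-1}\sigma(x_i,x_{i+1})$. On a locally finite graph this is a metric inducing the discrete topology. A pseudo metric $d$ is intrinsic if $\frac1{\mu(x)}\sum_{y}w(x,y)d(x,y)^2\le1$ for all $x\in X$; an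 intrinsic path (pseudo) metric $d_\sigma$ is strongly intrinsic if $\frac1{\mu(x)}\sum_{y}w(x,y)\sigma(x,y)^2\le1$ for all $x\in X$. $C_c(X)$ is the set of finitely supported functions, $L^2(X,\mu)$ has norm $\|u\|=(\sum_xu(x)^2\mu(x))^{1/2}$. For $f:X\to\mathbb R$ let $\widetilde Q(f)=\frac12\sum_{x,y\in X}w(x,y)(f(x)-f(y))^2\in[0,\infty]$ and $\|f\|_{\widetilde Q}=(\widetilde Q(f)+\|f\|^2)^{1/2}$. Set $D(Q^{\max})=\{f\in L^2(X,\mu)\mid\widetilde Q(f)<\infty\}$ and let $D(Q)$ be the closure of $C_c(X)$ in $D(Q^{\max})$ with respect to $\|\cdot\|_{\widetilde Q}$; $Q$ and $Q^{\max}$ are the restrictions of $\widetilde Q$ to these domains. For $U\subseteq X$ put $\mathrm{Cap}(U)=\inf\{\|u\|_{\widetilde Q}\mid u\in D(Q^{\max}),\ 1_U\le u\}$, with $\inf\emptyset=\infty$. Let $(\overline X,\overline d)$ be the metric completion of $(X,d)$ and $\partial_CX=\overline X\setminus X$ the Cauchy boundary. For $A\subseteq\overline X$ put $\mathrm{Cap}(A)=\inf\{\mathrm{Cap}(O\cap X)\mid A\subseteq O,\ O\subseteq\overline X\text{ open}\}$ (this agrees with the former definition for $A\subseteq X$). $\partial_CX$ is polar if $\mathrm{Cap}(\partial_CX)=0$. The formal Laplacian is $(\Delta f)(x)=\frac1{\mu(x)}\sum_{y\in X}w(x,y)(f(x)-f(y))$, which on a locally finite graph maps $C_c(X)$ to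 $C_c(X)$. A self-adjoint extension of $L_c$ on $L^2(X,\mu)$ is called Markovian if the quadratic form associated with it is a Dirichlet form. *)

(* Defs.v *)
From mathcomp Require Export all_boot all_order all_algebra.
From mathcomp Require Export all_classical all_reals all_analysis.

Set Implicit Arguments.
Unset Strict Implicit.
Unset Printing Implicit Defensive.

Import Order.TTheory GRing.Theory Num.Theory.
Import numFieldNormedType.Exports.

Local Open Scope classical_set_scope.
Local Open Scope ring_scope.

(* Completeness of the subset D for a real-valued distance function; dist is
   a bare function so that path distances, metrics of a metricType and form
   norms are all covered. *)
Section Completeness.
Context {R : realType} {T : Type}.
Implicit Types (dist : T -> T -> R) (u : nat -> T).

Definition cauchy_seq dist u : Prop :=
  forall e, 0 < e ->
    exists N, forall m n, (N <= m)%N -> (N <= n)%N -> dist (u m) (u n) < e.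

Definition cvg_seq dist u (l : T) : Prop :=
  forall e, 0 < e -> exists N, forall n, (N <= n)%N -> dist (u n) l < e.

Definition complete_on (D : set T) dist : Prop :=
  forall u, (forall n, D (u n)) -> cauchy_seq dist u ->
    exists2 l, D l & cvg_seq dist u l.

Definition metrically_complete dist : Prop := complete_on [set: T] dist.

End Completeness.

(* The vertex sequence x :: p is (x_0, ..., x_n) with n = size p >= 1. *)
Definition connects {X : eqType} (e : rel X) (x y : X) (p : seq X) : Prop :=
  [/\ p != [::], path e x p & last x p = y].

Record weighted_graph (R : realType) (X : countType) := WeightedGraph {
  weight : X -> X -> R ;
  meas : X -> R ;
  vertices_infinite : infinite_set [set: X] ;
  meas_gt0 : forall x, 0 < meas x ;
  weight_ge0 : forall x y, 0 <= weight x y ;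
  weight_sym : forall x y, weight x y = weight y x ;
  weight_diag : forall x, weight x x = 0 ;
  weight_summable :
    forall x, ((\esum_(y in [set: X]) (weight x y)%:E) < +oo)%E ;
  weight_connected : forall x y, x != y ->
    exists p, connects (fun a b => 0 < weight a b) x y p
}.

Section Graph.
Context {R : realType} {X : countType}.
Implicit Types (G : weighted_graph R X) (u v f : X -> R).

Definition adj G : rel X := fun x y => 0 < weight G x y.

Definition locally_finite G : Prop :=
  forall x, finite_set [set y | adj G x y].

Definition edge_length G (sigma : X -> X -> R) : Prop :=
  [/\ forall x y, 0 <= sigma x y,
      forall x y, sigma x y = sigma y x
    & forall x y, 0 < sigma x y <-> adj G x y].

Definition path_length (sigma : X -> X -> R) (x : X) (p : seq X) : R :=
  \sum_(e <- zip (x :: p) p) sigma e.1 e.2.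

Definition path_dist G (sigma : X -> X -> R) (x y : X) : R :=
  if x == y then 0
  else inf [set path_length sigma x p | p in connects (adj G) x y].

Definition intrinsic G (d : X -> X -> R) : Prop :=
  forall x, (((meas G x)^-1)%:E *
    (\esum_(y in [set: X]) (weight G x y * d x y ^+ 2)%:E) <= 1)%E.

Definition strongly_intrinsic G (sigma : X -> X -> R) : Prop :=
  intrinsic G (path_dist G sigma) /\
  forall x, (((meas G x)^-1)%:E *
    (\esum_(y in [set: X]) (weight G x y * sigma x y ^+ 2)%:E) <= 1)%E.

(* As meas > 0 everywhere, elements of L^2(X, meas) are genuine functions. *)
Definition l2sq G u : \bar R :=
  \esum_(x in [set: X]) (u x ^+ 2 * meas G x)%:E.

Definition L2 G : set (X -> R) := [set u | (l2sq G u < +oo)%E].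

Definition l2norm G u : \bar R := ((l2sq G u) `^ 2^-1)%E.

(* The sum of u x * v x * meas x, absolutely convergent on L^2. *)
Definition inner G u v : R :=
  let a := fun x => (u x * v x * meas G x)%:E in
  fine ((\esum_(x in [set: X]) a^\+ x) - (\esum_(x in [set: X]) a^\- x))%E.

Definition Cc : set (X -> R) := [set u | finite_set [set x | u x != 0]].

Definition energy G f : \bar R :=
  ((2^-1)%:E * (\esum_(p in [set: X * X])
     (weight G p.1 p.2 * (f p.1 - f p.2) ^+ 2)%:E))%E.

Definition energy_norm G f : \bar R :=
  ((energy G f + l2sq G f) `^ 2^-1)%E.

Definition DQmax G : set (X -> R) :=
  [set f | L2 G f /\ (energy G f < +oo)%E].

Definition DQ G : set (X -> R) :=
  [set f | DQmax G f /\
    forall e : R, 0 < e -> exists2 phi, Cc phi &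
      (energy_norm G (f \- phi)%R < e%:E)%E].

Definition cap G (U : set X) : \bar R :=
  ereal_inf [set energy_norm G u |
    u in [set u | DQmax G u /\ forall x, (\1_U x : R) <= u x]].

(* The completion is characterized, up to isometry, as a complete metric space
   containing (X, d) isometrically as a dense subset. *)
Definition is_completion (d : X -> X -> R)
    (Xbar : metricType R) (i : X -> Xbar) : Prop :=
  [/\ forall x y, mdist (i x) (i y) = d x y,
      dense (range i)
    & metrically_complete (@mdist R Xbar)].

Definition cauchy_boundary (Xbar : metricType R) (i : X -> Xbar) : set Xbar :=
  ~` range i.

Definition cap_completion G (Xbar : metricType R) (i : X -> Xbar)
    (A : set Xbar) : \bar R :=
  ereal_inf [set cap G (i @^-1` O) | O in [set O | A `<=` O /\ open O]].

Definition polar_boundary G (Xbar : metricType R) (i : X -> Xbar) : Prop :=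
  cap_completion G i (cauchy_boundary i) = 0%E.

(* \sum_(y \in A) is the finitely supported sum; on a locally finite graph the
   support, contained in the set of neighbors of x, is always finite. *)
Definition laplacian G f : X -> R := fun x =>
  (meas G x)^-1 * \sum_(y \in [set: X]) weight G x y * (f x - f y).

(* An unbounded operator is given by its graph, so that equality of operators
   includes equality of domains and inclusion is the extension relation. *)
Definition operator := set ((X -> R) * (X -> R)).
Implicit Types T : operator.

Definition op_dom T : set (X -> R) := [set u | exists f, T (u, f)].

Definition Lc G : operator := [set p | Cc p.1 /\ p.2 = laplacian G p.1].

Definition linear_subspace (D : set (X -> R)) : Prop :=
  D (cst 0) /\
  forall a u v, D u -> D v -> D (fun x => a * u x + v x).

Definition l2_dense G (D : set (X -> R)) : Prop :=
  forall f, L2 G f -> forall e : R, 0 < e ->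
    exists2 g, D g & (l2norm G (f \- g)%R < e%:E)%E.

Definition linear_operator G T : Prop :=
  [/\ forall u f, T (u, f) -> L2 G u /\ L2 G f,
      forall u f g, T (u, f) -> T (u, g) -> f = g,
      T (cst 0, cst 0)
    & forall a u f v g, T (u, f) -> T (v, g) ->
        T (fun x => a * u x + v x, fun x => a * f x + g x)].

Definition adjoint G T : operator :=
  [set p | [/\ L2 G p.1, L2 G p.2 &
     forall u f, T (u, f) -> inner G f p.1 = inner G u p.2]].

Definition self_adjoint G T : Prop :=
  [/\ linear_operator G T, l2_dense G (op_dom T) & T = adjoint G T].

(* fval is only meaningful on fdom. *)
Record form := Form {
  fdom : set (X -> R) ;
  fval : (X -> R) -> (X -> R) -> R
}.
Implicit Types E : form.

Definition symmetric_form G E : Prop :=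
  [/\ linear_subspace (fdom E) /\ (fdom E `<=` L2 G),
      l2_dense G (fdom E),
      forall a u v f, fdom E u -> fdom E v -> fdom E f ->
        fval E (fun x => a * u x + v x) f = a * fval E u f + fval E v f,
      forall u v, fdom E u -> fdom E v -> fval E u v = fval E v u
    & forall u, fdom E u -> 0 <= fval E u u].

Definition form_norm G E u : R :=
  Num.sqrt (fval E u u + fine (l2sq G u)).

Definition closed_form G E : Prop :=
  complete_on (fdom E) (fun u v => form_norm G E (u \- v)).

Definition normal_contraction (C : R -> R) : Prop :=
  C 0 = 0 /\ forall s t, `|C s - C t| <= `|s - t|.

Definition dirichlet_form G E : Prop :=
  [/\ symmetric_form G E, closed_form G E
    & forall C u, normal_contraction C -> fdom E u ->
        fdom E (C \o u) /\ fval E (C \o u) (C \o u) <= fval E u u].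

(* E |-> generator E is the standard one-to-one correspondence between densely
   defined closed nonnegative forms and nonnegative self-adjoint operators:
   T u = f iff u is in the domain of E and E(u, v) = <f, v> for all v there.
   Hence at most one closed form is associated with a given operator. *)
Definition generator G E : operator :=
  [set p | [/\ fdom E p.1, L2 G p.2 &
     forall v, fdom E v -> fval E p.1 v = inner G p.2 v]].

Definition associated G T E : Prop := T = generator G E.

Definition markovian_extension G T : Prop :=
  [/\ Lc G `<=` T, self_adjoint G T
    & exists2 E, dirichlet_form G E & associated G T E].

End Graph.

(* Main.v *)
Require Import Defs.
From mathcomp Require Import ring lra.

(* If the boundary is polar, u in D(Q^max) is first truncated to a bounded
   function, then multiplied by 1 - g with g a small-norm potential equal to 1
   near the boundary.  The product v lives on a set A which is closed in the
   completion, so that balls of A for the path metric with the lengths of edges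
   leaving A reset to 1 are finite (Hopf-Rinow, via Koenig's lemma); cutting off
   v along these balls approximates it by C_c(X).  Conversely, if u in D(Q) is at
   least 1 near the boundary and phi in C_c(X) is close to u, then |u - phi| is
   still at least 1 near the boundary, as a finite set is closed.
   For Markovian extensions: the generators of Q and Q^max are such extensions,
   and a closed form is determined by its generator.  If E is the Dirichlet form
   of any Markovian extension, projecting onto the E_1-harmonic functions off a
   finite set F bounds E_1(u) below by the energy of u inside F x F, whence
   D(Q) <= D(E) <= D(Q^max). *)

Set Implicit Arguments.
Unset Strict Implicit.
Unset Printing Implicit Defensive.

Import Order.TTheory GRing.Theory Num.Theory.
Import numFieldNormedType.Exports.

Local Open Scope classical_set_scope.
Local Open Scope ring_scope.


(** * Sums of real families *)

(** The strong form of intrinsicness enters through one estimate: the sum over x, y of w(x, y)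
    v(y)^2 sigma(x, y)^2 is at most the squared L^2 norm of v. It concerns [sigma] itself, which is
    what the cut-offs call for: they are Lipschitz for a modified edge length that agrees with
    [sigma] on the edges inside A, and not for the path metric. The truncation is forced by the
    product rule: the energy of u g contains u(y)^2 (g(x) - g(y))^2, which the energy of g controls
    only if u is bounded. The approximations by contractions, cut-offs, products and truncations all
    follow from one dominated convergence statement, [nrm_dct]: pointwise convergence plus a bound
    on squared values and increments. As every vertex has positive measure, norm convergence implies
    pointwise convergence, and this identifies limits taken in different norms. For Markovian
    extensions, the lower bound on E_1 is uniform in F, so enlarging F gives finite energy. It only
    serves to compare domains; the values of E are compared with those of Q on D(Q). *)

Section Sums.
Context {R : realType} {I : choiceType}.
Implicit Types (a b : I -> R) (e k : R).

Definition esm a : \bar R := \esum_(i in [set: I]) (a i)%:E.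

(** Copies the shape of the body of [inner], so that [innerE] holds by conversion. The value is only
    meaningful for absolutely summable families ([smb]). *)
Definition ssum a : R :=
  fine (\esum_(i in [set: I]) (EFin \o a)^\+%E i -
        \esum_(i in [set: I]) (EFin \o a)^\-%E i)%E.

Definition smb a : Prop := (esm (fun i => `|a i|)%R < +oo)%E.

Lemma esm_ge0 a : (forall i, 0 <= a i) -> (0 <= esm a)%E.
Proof. by move=> a0; apply: esum_ge0 => i _; rewrite lee_fin. Qed.

Lemma le_esm a b : (forall i, a i <= b i) -> (esm a <= esm b)%E.
Proof. by move=> ab; apply: le_esum => i _; rewrite lee_fin. Qed.

Lemma eq_esm a b : a =1 b -> esm a = esm b.
Proof. by move=> ab; congr esm; apply/funext. Qed.

Lemma esmD a b : (forall i, 0 <= a i) -> (forall i, 0 <= b i) ->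
  esm (fun i => a i + b i)%R = (esm a + esm b)%E.
Proof.
by move=> a0 b0; rewrite /esm -esumD// => i _; rewrite lee_fin.
Qed.

Lemma le_sum_esm a (s : seq I) : (forall i, 0 <= a i) -> uniq s ->
  ((\sum_(i <- s) a i)%:E <= esm a)%E.
Proof.
move=> a0 us; apply: esum_ge; exists [set` s].
  by split=> //; exact: finite_seq.
by rewrite -fsbig_seq// sumEFin.
Qed.

Lemma esm_le a (M : \bar R) :
  (forall s, uniq s -> ((\sum_(i <- s) a i)%:E <= M)%E) -> (esm a <= M)%E.
Proof.
move=> aM; apply: ge_ereal_sup => _ [F [finF _] <-].
rewrite fsbig_finite//= sumEFin; apply: aM; exact: finmap.fset_uniq.
Qed.

Lemma esm_seq a (s : seq I) : (forall i, 0 <= a i) -> uniq s ->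
  (forall i, i \notin s -> a i = 0) -> esm a = (\sum_(i <- s) a i)%:E.
Proof.
move=> a0 us as0; apply/eqP; rewrite eq_le le_sum_esm// andbT.
apply: esm_le => t ut; rewrite lee_fin.
rewrite (bigID (mem s))/= [X in _ + X]big1 ?addr0//.
have -> : \sum_(i <- t | i \in s) a i = \sum_(i <- s | i \in t) a i.
  rewrite -big_filter -[RHS]big_filter; apply: perm_big.
  apply: uniq_perm; rewrite ?filter_uniq// => i.
  by rewrite !mem_filter andbC.
by rewrite [leRHS](bigID (mem t))/= lerDl sumr_ge0.
Qed.

(** Partial sums give one inequality for every factor; the reverse one is the same inequality for
    k^-1. *)
Lemma esmZ k a : 0 <= k -> (forall i, 0 <= a i) ->
  esm (fun i => k * a i)%R = (k%:E * esm a)%E.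
Proof.
have H l b : 0 <= l -> (forall i, 0 <= b i) ->
    (esm (fun i => l * b i)%R <= l%:E * esm b)%E.
  move=> l0 b0; apply: esm_le => s us; rewrite -mulr_sumr EFinM.
  by apply: lee_wpmul2l; rewrite ?lee_fin// le_sum_esm.
move=> k0 a0; apply/eqP; rewrite eq_le H//=.
move: k0; rewrite [0 <= k]le_eqVlt => /predU1P[<-|k0].
  by rewrite mul0e esm_ge0// => i; rewrite mul0r.
rewrite -lee_pdivlMl//.
apply: le_trans (H k^-1 (fun i => k * a i) _ _).
- by apply: le_esm => i; rewrite mulKf// gt_eqF.
- by rewrite invr_ge0 ltW.
- by move=> i; rewrite mulr_ge0// ltW.
Qed.


Lemma smb_le a b : (forall i, `|a i| <= b i) -> (esm b < +oo)%E -> smb a.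
Proof. by move=> ab; apply: le_lt_trans; exact: le_esm. Qed.

Lemma smb_ge0 a : (forall i, 0 <= a i) -> smb a <-> (esm a < +oo)%E.
Proof.
by move=> a0; rewrite /smb (@eq_esm _ a)// => i; rewrite ger0_norm.
Qed.

Lemma esm_fin a : (forall i, 0 <= a i) -> smb a -> esm a \is a fin_num.
Proof. by move=> a0 /(smb_ge0 a0) ?; rewrite ge0_fin_numE// esm_ge0. Qed.

Lemma smbD a b : smb a -> smb b -> smb (fun i => a i + b i).
Proof. by move=> ha hb; exact: (@summableD _ _ _ (EFin \o a) (EFin \o b)). Qed.


Lemma smbZ k a : smb a -> smb (fun i => k * a i).
Proof.
move=> ha; apply: (@smb_le _ (fun i => `|k| * `|a i|)).
  by move=> i; rewrite normrM.
by rewrite esmZ// lte_mul_pinfty// lee_fin.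
Qed.

(** Here f and g need not be the positive and negative parts: any decomposition into nonnegative
    summable families gives the same value. Linearity of [ssum] then follows by regrouping
    nonnegative sums. *)
Lemma ssumBpos f g : smb f -> smb g -> (forall i, 0 <= f i) ->
  (forall i, 0 <= g i) ->
  ssum (fun i => f i - g i) = fine (esm f) - fine (esm g).
Proof.
move=> sf sg f0 g0; rewrite -fineB ?esm_fin//.
have H := @esumB _ _ _ (EFin \o f) (EFin \o g) sf sg
  (fun i _ => f0 i) (fun i _ => g0 i).
exact: (congr1 fine H).
Qed.

Lemma ssumE a : smb a -> exists f g,
  [/\ smb f, smb g, forall i, 0 <= f i, forall i, 0 <= g i &
      a = (fun i => f i - g i)].
Proof.
move=> sa; exists (fun i => Num.max (a i) 0), (fun i => Num.max (- a i) 0).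
split.
- apply: smb_le sa => i; rewrite maxEle; case: ifP; rewrite ?normr0//.
- apply: smb_le sa => i; rewrite maxEle; case: ifP; rewrite ?normr0 ?normrN//.
- by move=> i; rewrite le_max lexx orbT.
- by move=> i; rewrite le_max lexx orbT.
- apply/funext => i; rewrite !maxEle; case: ifP; case: ifP; lra.
Qed.

Lemma ssum_ge0E a : (forall i, 0 <= a i) -> ssum a = fine (esm a).
Proof.
move=> a0; rewrite /ssum; congr fine.
rewrite [X in (_ - X)%E]esum1 ?sube0; last first.
  by move=> i _; rewrite funenegE/= max_r// lee_fin oppr_le0.
by apply: eq_esum => i _; rewrite funeposE/= max_l// lee_fin.
Qed.


Lemma ssum_ge0 a : (forall i, 0 <= a i) -> 0 <= ssum a.
Proof. by move=> a0; rewrite ssum_ge0E// fine_ge0// esm_ge0. Qed.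

Lemma eq_ssum a b : a =1 b -> ssum a = ssum b.
Proof. by move=> /funext ->. Qed.

Lemma fine_esmD a b : smb a -> smb b -> (forall i, 0 <= a i) ->
  (forall i, 0 <= b i) ->
  fine (esm (fun i => a i + b i)) = fine (esm a) + fine (esm b).
Proof.
by move=> sa sb a0 b0; rewrite esmD// fineD ?esm_fin.
Qed.

Lemma ssumD a b : smb a -> smb b ->
  ssum (fun i => a i + b i) = ssum a + ssum b.
Proof.
move=> /ssumE[f [g [sf sg f0 g0 ->]]] /ssumE[h [k [sh sk h0 k0 ->]]].
rewrite !ssumBpos// (@eq_ssum _ (fun i => (f i + h i) - (g i + k i))); last first.
  by move=> i; ring.
rewrite ssumBpos; try exact: smbD; try by move=> i; rewrite addr_ge0.
rewrite (fine_esmD sf sh f0 h0) (fine_esmD sg sk g0 k0); ring.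
Qed.

Lemma ssumN a : smb a -> ssum (fun i => - a i) = - ssum a.
Proof.
move=> /ssumE[f [g [sf sg f0 g0 ->]]].
rewrite ssumBpos// (@eq_ssum _ (fun i => g i - f i)) ?ssumBpos ?opprB//.
by move=> i; rewrite opprB.
Qed.

Lemma ssumZ k a : smb a -> ssum (fun i => k * a i) = k * ssum a.
Proof.
wlog k0 : k / 0 <= k => [H|].
  have [k0|k0] := leP 0 k; first exact: H.
  move=> sa; rewrite (@eq_ssum _ (fun i => - ((- k) * a i))); last first.
    by move=> i; rewrite mulNr opprK.
  rewrite ssumN; last exact: smbZ.
  by rewrite H// ?oppr_ge0 ?ltW// mulNr opprK.
move=> /ssumE[f [g [sf sg f0 g0 ->]]].
rewrite ssumBpos// (@eq_ssum _ (fun i => k * f i - k * g i)); last first.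
  by move=> i; rewrite mulrBr.
rewrite ssumBpos; try exact: smbZ; try by move=> i; rewrite mulr_ge0.
by rewrite (esmZ k0 f0) (esmZ k0 g0) !fineM ?esm_fin// mulrBr.
Qed.

Lemma smb_seq a (s : seq I) : uniq s -> (forall i, i \notin s -> a i = 0) ->
  smb a.
Proof.
move=> us bs; rewrite /smb (@esm_seq (fun i => `|a i|) s) ?ltry// => i /bs ->.
by rewrite normr0.
Qed.

Lemma ssum_seq a (s : seq I) : uniq s ->
  (forall i, i \notin s -> a i = 0) -> ssum a = \sum_(i <- s) a i.
Proof.
move=> us as0.
have smbs b := @smb_seq b s us.
have [f [g [sf sg f0 g0 E]]] := ssumE (smbs _ as0).
pose z (h : I -> R) i := if i \in s then h i else 0.
have zs h : forall i, i \notin s -> z h i = 0.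
  by move=> i; rewrite /z => /negPf ->.
have z0 h : (forall i, 0 <= h i) -> forall i, 0 <= z h i.
  by move=> h0 i; rewrite /z; case: ifP.
have zE h : \sum_(i <- s) z h i = \sum_(i <- s) h i.
  by apply: eq_big_seq => i si; rewrite /z si.
rewrite (@eq_ssum _ (fun i => z f i - z g i)); last first.
  move=> i; rewrite /z; case: ifPn => [_|/as0//]; first by rewrite E.
  by rewrite subrr.
rewrite (ssumBpos (smbs _ (zs f)) (smbs _ (zs g)) (z0 _ f0) (z0 _ g0)).
rewrite (esm_seq (z0 _ f0) us (zs f)) (esm_seq (z0 _ g0) us (zs g)).
by rewrite /= !zE -sumrB E.
Qed.

Lemma esm_tail b e : (forall i, 0 <= b i) -> (esm b < +oo)%E -> 0 < e ->
  exists2 s, uniq s & (esm (fun i => if i \in s then 0 else b i)%R < e%:E)%E.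
Proof.
move=> b0 bfin e0.
have bf : esm b \is a fin_num by rewrite ge0_fin_numE// esm_ge0.
have [s us sP] : exists2 s : seq I, uniq s & (esm b - e%:E < (\sum_(i <- s) b i)%R%:E)%E.
  apply: contrapT => H.
  have : (esm b <= esm b - e%:E)%E.
    apply: esm_le => s us; rewrite leNgt; apply/negP => lt.
    by apply: H; exists s.
  by rewrite -(fineK bf) -EFinB lee_fin; lra.
exists s => //.
pose g i := if i \in s then b i else 0; pose h i := if i \in s then 0 else b i.
rewrite -/h.
have g0 i : 0 <= g i by rewrite /g; case: ifP.
have h0 i : 0 <= h i by rewrite /h; case: ifP.
have E : esm b = (esm g + esm h)%E.
  by rewrite -esmD//; apply: eq_esm => i; rewrite /g/h; case: ifP;
    rewrite ?addr0 ?add0r.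
have gE : esm g = (\sum_(i <- s) b i)%:E.
  rewrite (@esm_seq g s)//; last by move=> i; rewrite /g => /negPf ->.
  by congr (_%:E); apply: eq_big_seq => i si; rewrite /g si.
have := bf; rewrite E fin_numD => /andP[_ tf].
by move: sP; rewrite E gE -(fineK tf) -!EFinD !lte_fin; lra.
Qed.

(** Dominated convergence to 0 in which the bound may vary with n, as long as its varying part [a n]
    has sum tending to 0. Outside a finite set s the fixed part b contributes less than e/3; on s
    pointwise convergence suffices. *)
Lemma esm_dct (f a : nat -> I -> R) b :
  (forall n i, 0 <= f n i) -> (forall i, 0 <= b i) -> (forall n i, 0 <= a n i) ->
  (forall n i, f n i <= b i + a n i) ->
  (esm b < +oo)%E ->
  (forall e : R, 0 < e -> \forall n \near \oo, (esm (a n) < e%:E)%E) ->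
  (forall i (e : R), 0 < e -> \forall n \near \oo, f n i < e) ->
  forall e : R, 0 < e -> \forall n \near \oo, (esm (f n) < e%:E)%E.
Proof.
move=> f0 b0 a0 fba bfin acv fcv e e0.
have e3 : 0 < e / 3 by rewrite divr_gt0.
have [s us tl] := esm_tail b0 bfin e3.
(* An equal share of e/3 for each element of s; the successor covers empty s and makes the total
   strictly smaller than e/3. *)
have d0 : 0 < e / 3 / (size s).+1%:R by rewrite divr_gt0.
have : \forall n \near \oo, forall i, i \in s -> f n i < e / 3 / (size s).+1%:R.
  move: d0; move: (_ / (size s).+1%:R : R) => d d0.
  elim: (s) => [|x t IH]; first by apply: nearW => n i.
  apply: (filterS2 _ _ IH (fcv x _ d0)) => n H1 H2 i.
  by rewrite inE => /predU1P[->//|]; exact: H1.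
apply: filterS2 (acv _ e3) => n an fn.
have sfn : \sum_(i <- s) f n i < e / 3.
  apply: (@le_lt_trans _ _ (\sum_(i <- s) (e / 3 / (size s).+1%:R))).
    by rewrite big_seq [leRHS]big_seq; apply: ler_sum => i /fn/ltW.
  rewrite big_const_seq count_predT iter_addr_0 -[ltLHS]mulr_natl.
  by rewrite mulrCA gtr_pMr// ltr_pdivrMr// mul1r ltr_nat.
pose g i := if i \in s then 0 else b i.
have g0 i : 0 <= g i by rewrite /g; case: ifP.
pose h i := if i \in s then f n i else 0.
have h0 i : 0 <= h i by rewrite /h; case: ifP.
apply: (@le_lt_trans _ _ (esm (fun i => h i + (g i + a n i)))).
  apply: le_esm => i; rewrite /h /g; case: ifP => _; last by rewrite add0r.
  by rewrite add0r lerDl.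
rewrite esmD//; last by move=> i; rewrite addr_ge0.
rewrite esmD// (@esm_seq h s)//; last by move=> i; rewrite /h => /negPf ->.
rewrite (@eq_big_seq _ _ _ _ s _ (f n)); last by move=> i; rewrite /h => ->.
move: tl an; rewrite -/(esm g) => tl an.
have gf : esm g \is a fin_num by rewrite ge0_fin_numE ?esm_ge0// (lt_trans tl) ?ltry.
have af : esm (a n) \is a fin_num by rewrite ge0_fin_numE ?esm_ge0// (lt_trans an) ?ltry.
move: tl an; rewrite -(fineK gf) -(fineK af) -!EFinD !lte_fin; lra.
Qed.

Lemma esm_fatou (f : nat -> I -> R) a M :
  (forall n i, 0 <= f n i) ->
  (forall i (e : R), 0 < e -> \forall n \near \oo, a i < f n i + e) ->
  (\forall n \near \oo, (esm (f n) <= M%:E)%E) -> (esm a <= M%:E)%E.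
Proof.
move=> f0 fa fM; apply: esm_le => s us; rewrite lee_fin.
apply/ler_addgt0Pr => e e0.
have d0 : 0 < e / (size s).+1%:R by rewrite divr_gt0.
have : \forall n \near \oo, forall i, i \in s -> a i < f n i + e / (size s).+1%:R.
  move: d0; move: (_ / (size s).+1%:R : R) => d d0.
  elim: (s) => [|x t IH]; first by apply: nearW => n i.
  apply: (filterS2 _ _ IH (fa x _ d0)) => n H1 H2 i.
  by rewrite inE => /predU1P[->//|]; exact: H1.
move=> H; near \oo => n.
apply: (@le_trans _ _ (\sum_(i <- s) (f n i + e / (size s).+1%:R))).
  rewrite big_seq [leRHS]big_seq; apply: ler_sum => i si; apply: ltW.
  by apply: (near H n) => //.
rewrite big_split/= lerD//.
  rewrite -lee_fin; apply: le_trans (near fM n _) => //.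
  exact: le_sum_esm.
rewrite big_const_seq count_predT iter_addr_0 -[leLHS]mulr_natl.
by rewrite mulrCA ger_pMr// ler_pdivrMr// mul1r ler_nat.
Unshelve. all: by end_near.
Qed.
End Sums.

Lemma notin_allpairs (T : eqType) (S : seq T) (x y : T) :
  (x, y) \notin [seq (x, y) | x <- S, y <- S] -> (x \notin S) || (y \notin S).
Proof.
apply: contraR; rewrite negb_or !negbK => /andP[xS yS].
by apply/allpairsP; exists (x, y).
Qed.

(** A finite set of pairs is contained in a square F x F, and enlarging it only increases a
    nonnegative sum. Bounds on double sums over finite F therefore suffice for energies. *)
Lemma esm_pair_le {R : realType} (T : choiceType) (a : T * T -> R) (M : R) :
  (forall p, 0 <= a p) ->
  (forall F, uniq F -> \sum_(x <- F) \sum_(y <- F) a (x, y) <= M) ->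
  (esm a <= M%:E)%E.
Proof.
move=> a0 aM; apply: esm_le => P uP; rewrite lee_fin.
pose F := undup (map fst P ++ map snd P).
have uF : uniq F by exact: undup_uniq.
have PF x y : (x, y) \in P -> x \in F /\ y \in F.
  move=> xyP; rewrite !mem_undup !mem_cat; split; apply/orP.
    by left; apply/mapP; exists (x, y).
  by right; apply/mapP; exists (x, y).
pose Q := [seq (x, y) | x <- F, y <- F].
pose b p := if p \in Q then a p else 0.
have b0 p : 0 <= b p by rewrite /b; case: ifP.
have uQ : uniq Q by rewrite /Q allpairs_uniq// => -[x y] [x' y'] _ _.
have -> : \sum_(p <- P) a p = \sum_(p <- P) b p.
  apply: eq_big_seq => -[x y] /PF[xF yF]; rewrite /b ifT//.
  by apply/allpairsP; exists (x, y).
rewrite -lee_fin; apply: le_trans (le_sum_esm b0 uP) _.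
rewrite (esm_seq b0 uQ); last by move=> p; rewrite /b => /negPf ->.
rewrite lee_fin (_ : \sum_(p <- Q) b p = \sum_(p <- Q) a p); last first.
  by apply: eq_big_seq => p pQ; rewrite /b pQ.
by rewrite big_allpairs; exact: aM.
Qed.

(** * Complete positive semidefinite forms *)

Lemma natSinv_small {R : realType} (e : R) : 0 < e ->
  exists N, forall n, (N <= n)%N -> (n.+1%:R^-1 : R) < e.
Proof.
move=> e0; have [N _ NP] := near_infty_natSinv_lt (PosNum e0).
by exists N => n /NP.
Qed.

Lemma sqrt_lt {R : realType} (x e : R) : 0 < e -> (Num.sqrt x < e) = (x < e ^+ 2).
Proof.
move=> e0; rewrite -{1}[e]gtr0_norm// -sqrtr_sqr ltr_sqrt// exprn_gt0//.
Qed.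

Lemma quad_discr {R : realType} (a b c : R) : 0 <= a ->
  (forall t, 0 <= a * t ^+ 2 + 2 * b * t + c) -> b ^+ 2 <= a * c.
Proof.
rewrite le_eqVlt => /predU1P[<- H|a0 H].
  rewrite mul0r; have [->|b0] := eqVneq b 0; first by rewrite expr0n.
  (* Without a quadratic term and with b nonzero, the polynomial takes the value -1 here. *)
  have := H (- (c + 1) / (2 * b)).
  rewrite (_ : _ + _ + c = -1); last by field.
  lra.
have a1 : a != 0 by rewrite gt_eqF.
have := H (- b / a).
rewrite (_ : _ + _ + c = (a * c - b ^+ 2) / a); last by field.
by rewrite pmulr_lge0 ?invr_gt0// subr_ge0.
Qed.

Lemma lin_le0 {R : realType} (b c : R) : 0 <= c ->
  (forall t, 0 <= 2 * b * t + c * t ^+ 2) -> b = 0.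
Proof.
move=> c0 H; apply/eqP; rewrite -sqrf_eq0 eq_le sqr_ge0 andbT.
rewrite -[leRHS](mulr0 c); apply: quad_discr => // t.
by rewrite addr0 addrC; exact: H.
Qed.

(** Relative to a domain D, since forms are total functions whose values only matter on D. On
    functions, [a *: u + v] is convertible to the pointwise combination used for operators and
    forms. *)
Definition psd_form {R : realType} {V : lmodType R} (D : set V)
    (B : V -> V -> R) : Prop :=
  [/\ D 0, (forall a u v, D u -> D v -> D (a *: u + v)),
    forall a u v f, D u -> D v -> D f ->
      B (a *: u + v) f = a * B u f + B v f,
    forall u v, D u -> D v -> B u v = B v u
  & forall u, D u -> 0 <= B u u].

Section PsdForm.
Context {R : realType} {V : lmodType R} (D : set V) (B : V -> V -> R).
Hypothesis psdB : psd_form D B.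
Implicit Types u v f : V.

Lemma psd_D0 : D 0. Proof. by case: psdB. Qed.

Lemma psd_Dlin a u v : D u -> D v -> D (a *: u + v).
Proof. by case: psdB => _ H _ _ _; exact: H. Qed.

Lemma psd_DD u v : D u -> D v -> D (u + v).
Proof. by move=> Du Dv; rewrite -[u]scale1r; exact: psd_Dlin. Qed.

Lemma psd_DZ a u : D u -> D (a *: u).
Proof. by move=> Du; rewrite -[_ *: _]addr0; apply: psd_Dlin => //; exact: psd_D0. Qed.

Lemma psd_DB u v : D u -> D v -> D (u - v).
Proof. by move=> Du Dv; rewrite addrC -scaleN1r; exact: psd_Dlin. Qed.

Lemma psd_lin a u v f : D u -> D v -> D f ->
  B (a *: u + v) f = a * B u f + B v f.
Proof. by case: psdB => _ _ H _ _; exact: H. Qed.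

Lemma psd_sym u v : D u -> D v -> B u v = B v u.
Proof. by case: psdB => _ _ _ H _; exact: H. Qed.

Lemma psd_ge0 u : D u -> 0 <= B u u.
Proof. by case: psdB => _ _ _ _ H; exact: H. Qed.

Lemma psd_linr a u v f : D u -> D v -> D f ->
  B f (a *: u + v) = a * B f u + B f v.
Proof.
by move=> Du Dv Df; rewrite psd_sym ?psd_lin// ?(psd_sym Df)//; exact: psd_Dlin.
Qed.

Lemma psd_Bl u v f : D u -> D v -> D f -> B (u - v) f = B u f - B v f.
Proof. by move=> Du Dv Df; rewrite addrC -scaleN1r psd_lin// mulN1r addrC. Qed.

Lemma psd_Br u v f : D u -> D v -> D f -> B f (u - v) = B f u - B f v.
Proof. by move=> Du Dv Df; rewrite addrC -scaleN1r psd_linr// mulN1r addrC. Qed.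

Lemma psd_quad a u v : D u -> D v ->
  B (a *: u + v) (a *: u + v) = B u u * a ^+ 2 + 2 * B u v * a + B v v.
Proof.
move=> Du Dv; have Duv := psd_Dlin a Du Dv.
rewrite psd_lin// !psd_linr// (psd_sym Dv Du); ring.
Qed.

Lemma psd_cs u v : D u -> D v -> B u v ^+ 2 <= B u u * B v v.
Proof.
move=> Du Dv; apply: quad_discr => [|t]; first exact: psd_ge0.
by rewrite -psd_quad// psd_ge0//; exact: psd_Dlin.
Qed.

Lemma psd_qB u v : D u -> D v -> B (u - v) (u - v) = B u u - 2 * B u v + B v v.
Proof.
move=> Du Dv; have Duv := psd_DB Du Dv.
rewrite psd_Bl// !psd_Br// (psd_sym Dv Du); ring.
Qed.

Lemma psd_qD u v : D u -> D v -> B (u + v) (u + v) = B u u + 2 * B u v + B v v.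
Proof.
by move=> Du Dv; have := psd_quad 1 Du Dv; rewrite scale1r => ->; ring.
Qed.

(** Riesz representation for a possibly degenerate B, without passing to a quotient: a minimizing
    sequence of J v = B(v, v) - 2 l(v) is Cauchy for the seminorm, and vanishing of the first
    variation at a limit is the claim. *)
Theorem riesz (l : V -> R) (C : R) :
  complete_on D (fun u v => Num.sqrt (B (u - v) (u - v))) ->
  (forall a u v, D u -> D v -> l (a *: u + v) = a * l u + l v) ->
  (forall v, D v -> l v ^+ 2 <= C * B v v) ->
  exists2 u, D u & forall v, D v -> B u v = l v.
Proof.
move=> cplD lin lC.
have C'P v : D v -> l v ^+ 2 <= `|C| * B v v.
  move=> Dv; apply: le_trans (lC v Dv) _.
  by rewrite ler_wpM2r ?psd_ge0 ?ler_norm.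
pose J v := B v v - 2 * l v.
pose S := [set J v | v in D].
(* With c = |C| and b = B(v, v), l(v)^2 <= c b gives 2 l(v) <= c + b. *)
have Slb : lbound S (- `|C|).
  move=> _ [v Dv <-]; rewrite /J; have := C'P v Dv; have := psd_ge0 Dv.
  have := normr_ge0 C; move: `|C| (B v v) (l v) => c b x c0 b0 h.
  rewrite lerBrDl -subr_ge0 opprB addrA subr_ge0.
  have [x0|x0] := leP x 0; first lra.
  rewrite -(@ler_pXn2r _ 2) ?nnegrE; [|by []|lra|lra].
  have := sqr_ge0 (c - b); nra.
have Sinf : has_inf S.
  split; last by exists (- `|C|).
  by exists (J 0); exists 0 => //; exact: psd_D0.
have Jge v : D v -> inf S <= J v.
  by move=> Dv; apply: ge_inf; [case: Sinf|exists v].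
have uP n : exists v, D v /\ J v < inf S + n.+1%:R^-1.
  have : 0 < (n.+1%:R^-1 : R) by rewrite invr_gt0.
  by move=> /(inf_adherent)/(_ Sinf)[_ [v Dv <-] h]; exists v.
have [u uH] := choice uP.
have Du n : D (u n) by case: (uH n).
have Ju n : J (u n) < inf S + n.+1%:R^-1 by case: (uH n).
have linD v w : D v -> D w -> l (v + w) = l v + l w.
  by move=> Dv Dw; have := lin 1 v w Dv Dw; rewrite scale1r mul1r.
have l0 : l 0 = 0.
  have := linD _ _ psd_D0 psd_D0; rewrite addr0 => /eqP.
  by rewrite -subr_eq0 opprD addrA subrr sub0r oppr_eq0 => /eqP.
have linZ a v : D v -> l (a *: v) = a * l v.
  by move=> Dv; have := lin a v 0 Dv psd_D0; rewrite l0 !addr0.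
(* Parallelogram identity: B(u - v, u - v) = 2 J(u) + 2 J(v) - 4 J((u + v) / 2), and J at the
   midpoint is at least the infimum. *)
have para m n : B (u m - u n) (u m - u n) <= 2 * m.+1%:R^-1 + 2 * n.+1%:R^-1.
  have Dmn := psd_DD (Du m) (Du n).
  have := Jge _ (psd_DZ 2^-1 Dmn).
  rewrite /J linZ// linD//.
  have := psd_quad 2^-1 Dmn psd_D0; rewrite addr0 => ->.
  have B0 w : D w -> B w 0 = 0.
    by move=> Dw; have := psd_Br (Du 0) (Du 0) Dw; rewrite !subrr.
  rewrite (B0 _ Dmn) (B0 _ psd_D0) (psd_qD (Du m) (Du n)) (psd_qB (Du m) (Du n)).
  have := Ju m; have := Ju n; rewrite /J.
  move: (m.+1%:R^-1) (n.+1%:R^-1) (B _ _) (B _ _) (B _ _) => x y b1 b2 b3.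
  lra.
have [|w Dw uw] := cplD u Du.
  move=> e e0.
  have e2 : 0 < e ^+ 2 / 4 by rewrite divr_gt0// exprn_gt0.
  have [N NP] := natSinv_small e2.
  exists N => m n mN nN.
  have := NP m mN; have := NP n nN => hn hm.
  rewrite sqrt_lt//.
  apply: le_lt_trans (para m n) _.
  by move: hn hm; move: (m.+1%:R^-1) (n.+1%:R^-1) (e ^+ 2) => x y z; lra.
exists w => // v Dv; apply/eqP; rewrite -subr_eq0; apply/eqP.
(* The first variation: J(u n + t v) is compared with J(u n), nearly minimal, and then n is sent to
   infinity. The constant K absorbs the error 2 t B(u n - w, v), estimated by Cauchy-Schwarz. *)
apply: (@lin_le0 _ _ (B v v)) => [|t]; first exact: psd_ge0.
apply/ler_addgt0Pr => e e0.
pose K := 1 + 2 * `|t| * (1 + B v v).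
have K0 : 0 < K by rewrite /K; have := psd_ge0 Dv; have := normr_ge0 t; nra.
have d0 : 0 < e / 2 / K by rewrite !divr_gt0.
pose d := Num.min 1 (e / 2 / K).
have dd : 0 < d by rewrite /d lt_min d0 ltr01.
have [N NP] := uw _ dd.
have e2 : 0 < e / 2 by rewrite divr_gt0.
have [M MP] := natSinv_small e2.
pose n := maxn N M.
have := NP n (leq_maxl _ _); have hM := MP n (leq_maxr _ _).
have Dnw := psd_DB (Du n) Dw.
set s := Num.sqrt _ => sd.
have s0 : 0 <= s by exact: sqrtr_ge0.
have sE : s ^+ 2 = B (u n - w) (u n - w) by rewrite sqr_sqrtr// psd_ge0.
have cs : `|B (u n - w) v| <= s * (1 + B v v).
  rewrite -(@ler_pXn2r _ 2) ?nnegrE//; last first.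
    by rewrite mulr_ge0// addr_ge0// psd_ge0.
  rewrite real_normK ?num_real// exprMn sE.
  apply: le_trans (psd_cs Dnw Dv) _; rewrite ler_wpM2l ?psd_ge0//.
  by have := psd_ge0 Dv; nra.
have := Jge _ (psd_Dlin t Dv (Du n)).
rewrite /J psd_quad// lin// (psd_sym Dv (Du n)).
have := Ju n; rewrite /J => h1 h2.
have Bd : B (u n) v = B w v + B (u n - w) v by rewrite psd_Bl//; ring.
rewrite Bd in h2.
have h3 : `|2 * t * B (u n - w) v| <= e / 2.
  rewrite !normrM normr_nat.
  have dE : d * K <= e / 2.
    rewrite -ler_pdivlMr//; by rewrite /d ge_min lexx orbT.
  apply: le_trans dE; have := normr_ge0 t.
  move: cs sd s0 (psd_ge0 Dv) dd; rewrite /K.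
  move: `|t| `|B _ v| (B v v) => t' x b cs sd s0 b0 dd t0.
  have : 2 * t' * x <= 2 * t' * (d * (1 + b)).
    rewrite ler_wpM2l// ?mulr_ge0//; apply: le_trans cs _.
    by rewrite ler_wpM2r ?addr_ge0// ltW.
  nra.
move: h3; rewrite ler_norml => /andP[h3 h4].
by move: h1 h2 h3 h4 hM; move: (inf S) (n.+1%:R^-1) => x y; nra.
Qed.

End PsdForm.

(** * The energy norm *)

Lemma sqr_le_norm {R : realType} (a b : R) : `|a| <= `|b| -> a ^+ 2 <= b ^+ 2.
Proof.
move=> ab; rewrite -(real_normK (num_real a)) -(real_normK (num_real b)).
by rewrite ler_pXn2r// nnegrE.
Qed.

Lemma sqr_lt_norm {R : realType} (a b : R) : 0 < b -> (a ^+ 2 < b ^+ 2) = (`|a| < b).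
Proof.
move=> b0; rewrite -(real_normK (num_real a)).
by rewrite ltr_pXn2r// nnegrE// ltW.
Qed.

Lemma sqrD_le {R : realType} (a b : R) : (a + b) ^+ 2 <= 2 * a ^+ 2 + 2 * b ^+ 2.
Proof. by have := sqr_ge0 (a - b); nra. Qed.

Section GraphForms.
Context {R : realType} {X : countType} (G : weighted_graph R X).
Implicit Types (u v f phi : X -> R) (e : R).
Local Notation w := (weight G).
Local Notation mu := (meas G).

Definition gsq u (p : X * X) : R := w p.1 p.2 * (u p.1 - u p.2) ^+ 2.
Definition lsq u x : R := u x ^+ 2 * mu x.

(* Equivalent to the square of the energy norm, without the factor 1/2. *)
Definition nrm u : \bar R := (esm (gsq u) + esm (lsq u))%E.

Definition cv0 (f : nat -> \bar R) : Prop :=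
  forall e, 0 < e -> \forall n \near \oo, (f n < e%:E)%E.

Definition pw0 (v : nat -> X -> R) : Prop :=
  forall x e, 0 < e -> \forall n \near \oo, `|v n x| < e.

Lemma meas_ge0 x : 0 <= mu x. Proof. by rewrite ltW ?meas_gt0. Qed.

Lemma gsq_ge0 u p : 0 <= gsq u p.
Proof. by rewrite mulr_ge0 ?weight_ge0 ?sqr_ge0. Qed.

Lemma lsq_ge0 u x : 0 <= lsq u x.
Proof. by rewrite mulr_ge0 ?sqr_ge0// ltW ?meas_gt0. Qed.

Hint Resolve gsq_ge0 lsq_ge0 : core.

Lemma nrm_ge0 u : (0 <= nrm u)%E.
Proof. by rewrite adde_ge0// esm_ge0. Qed.

Lemma gsq_le_nrm u : (esm (gsq u) <= nrm u)%E.
Proof. by rewrite leeDl// esm_ge0. Qed.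

Lemma lsq_le_nrm u : (esm (lsq u) <= nrm u)%E.
Proof. by rewrite leeDr// esm_ge0. Qed.

Lemma DQmaxE u : DQmax G u <-> (nrm u < +oo)%E.
Proof.
have energyE : energy G u = (2^-1%:E * esm (gsq u))%E by [].
rewrite /DQmax/= /L2/= energyE; split=> [[l2 en]|lt].
  rewrite /nrm lte_add_pinfty//.
  move: en; case: (esm (gsq u)) => //=; first by move=> r _; exact: ltry.
  by rewrite gt0_muley// lte_fin.
split; first exact: le_lt_trans (lsq_le_nrm u) lt.
by rewrite lte_mul_pinfty// ?lee_fin//; exact: le_lt_trans (gsq_le_nrm u) lt.
Qed.

Lemma nrm_le u v : (forall x, `|u x| <= `|v x|) ->
  (forall x y, `|u x - u y| <= `|v x - v y|) -> (nrm u <= nrm v)%E.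
Proof.
move=> uv duv; apply: leeD; apply: le_esm.
  move=> [x y]; rewrite ler_wpM2l ?weight_ge0//=.
  exact/sqr_le_norm/duv.
move=> x; rewrite ler_wpM2r ?meas_ge0//.
exact/sqr_le_norm/uv.
Qed.

Lemma nrmN u : nrm (fun x => - u x) = nrm u.
Proof.
apply/eqP; rewrite eq_le !nrm_le// => x; rewrite ?normrN// => y.
- by rewrite -opprD normrN.
- by rewrite -opprD normrN.
Qed.

Lemma nrmD u v : (nrm (fun x => u x + v x)%R <= 2%:E * nrm u + 2%:E * nrm v)%E.
Proof.
have lin (I : choiceType) (a b c : I -> R) : (forall i, 0 <= a i) ->
    (forall i, 0 <= b i) -> (forall i, c i <= 2 * a i + 2 * b i) ->
    (esm c <= 2%:E * esm a + 2%:E * esm b)%E.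
  move=> a0 b0 cab; rewrite -!esmZ// -esmD//; first exact: le_esm.
  - by move=> i; rewrite mulr_ge0.
  - by move=> i; rewrite mulr_ge0.
rewrite /nrm !ge0_muleDr ?esm_ge0// addeACA; apply: leeD; apply: lin => //.
- move=> [x y]; rewrite /gsq/= !mulrA ![2 * _]mulrC -!mulrA -mulrDr.
  rewrite ler_wpM2l ?weight_ge0//; have := sqr_ge0 (u x - u y - (v x - v y)).
  nra.
- move=> x; rewrite /lsq !mulrA -mulrDl ler_wpM2r ?meas_ge0//.
  by have := sqr_ge0 (u x - v x); nra.
Qed.

Lemma nrmB u v : (nrm (fun x => u x - v x)%R <= 2%:E * nrm u + 2%:E * nrm v)%E.
Proof. by rewrite -(nrmN v); exact: nrmD. Qed.

(** Since [nrm] is a squared norm, its triangle inequality costs a factor 2 on each term; hence the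
    quarters of e. *)
Lemma nrm_split u v e : 0 < e -> (nrm (fun x => u x)%R < (e / 4)%:E)%E ->
  (nrm v < (e / 4)%:E)%E -> (nrm (fun x => u x + v x)%R < e%:E)%E.
Proof.
move=> e0 ue ve; apply: le_lt_trans (nrmD u v) _.
have uf : nrm u \is a fin_num by rewrite ge0_fin_numE ?nrm_ge0// (lt_trans ue) ?ltry.
have vf : nrm v \is a fin_num by rewrite ge0_fin_numE ?nrm_ge0// (lt_trans ve) ?ltry.
move: ue ve; rewrite -(fineK uf) -(fineK vf) -!EFinM -EFinD !lte_fin; lra.
Qed.

Lemma lsq_lt u x e : (nrm u < e%:E)%E -> u x ^+ 2 * mu x < e.
Proof.
move=> ue; rewrite -lte_fin; apply: le_lt_trans ue.
apply: le_trans (lsq_le_nrm u); rewrite -[u x ^+ 2 * _]/(lsq u x).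
by have := @le_sum_esm _ _ (lsq u) [:: x] (lsq_ge0 u) isT; rewrite big_seq1.
Qed.

Lemma nrm_pw1 u x e : 0 < e -> (nrm u < (e ^+ 2 * mu x)%:E)%E -> `|u x| < e.
Proof.
move=> e0 /(lsq_lt x); rewrite ltr_pM2r ?meas_gt0//.
by rewrite sqr_lt_norm.
Qed.

Lemma nrm_pw (v : nat -> X -> R) : cv0 (nrm \o v) -> pw0 v.
Proof.
move=> v0 x e e0; have H : 0 < e ^+ 2 * mu x by rewrite mulr_gt0 ?meas_gt0 ?exprn_gt0.
by apply: filterS (v0 _ H) => n; exact: nrm_pw1.
Qed.

(** Product rules and contractions bound the increments of v n by a fixed summable family plus a
    multiple of those of some [psi n] tending to 0 in norm. Pointwise convergence of v n then
    upgrades to norm convergence. *)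
Lemma nrm_dct (v psi : nat -> X -> R) (C : R) (b1 : X * X -> R) (b2 : X -> R) :
  0 < C -> (forall p, 0 <= b1 p) -> (forall x, 0 <= b2 x) ->
  (esm b1 < +oo)%E -> (esm b2 < +oo)%E ->
  (forall n p, gsq (v n) p <= b1 p + C * gsq (psi n) p) ->
  (forall n x, lsq (v n) x <= b2 x + C * lsq (psi n) x) ->
  cv0 (nrm \o psi) -> pw0 v -> cv0 (nrm \o v).
Proof.
move=> C0 b10 b20 b1f b2f gv lv psi0 v0.
have cvC (I : choiceType) (a : nat -> I -> R) : (forall n i, 0 <= a n i) ->
    (forall n, (esm (a n) <= nrm (psi n))%E) ->
    forall e, 0 < e -> \forall n \near \oo, (esm (fun i => C * a n i)%R < e%:E)%E.
  move=> a0 an e e0; have eC : 0 < e / C by rewrite divr_gt0.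
  apply: filterS (psi0 _ eC) => n /= h.
  rewrite esmZ ?ltW// muleC -lte_pdivlMr// -EFinM.
  exact: le_lt_trans (an n) h.
have sq x e : 0 < e -> \forall n \near \oo, v n x ^+ 2 < e.
  move=> e0; have d0 : 0 < Num.min 1 e by rewrite lt_min e0 ltr01.
  apply: filterS (v0 x _ d0) => n; rewrite lt_min => /andP[h1 h2].
  rewrite -(real_normK (num_real (v n x))); have := normr_ge0 (v n x); nra.
move=> e e0; have e2 : 0 < e / 2 by rewrite divr_gt0.
have H1 : \forall n \near \oo, (esm (gsq (v n)) < (e / 2)%:E)%E.
  apply: (@esm_dct _ _ (fun n => gsq (v n)) (fun n p => C * gsq (psi n) p) b1) => //.
  - by move=> n p; rewrite mulr_ge0// ltW.
  - by apply: cvC => // n; exact: gsq_le_nrm.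
  - move=> [x y] d d0; rewrite /gsq/=.
    (* Chosen so that w(x, y) (a - b)^2 <= 2 w(x, y) (a^2 + b^2) < d once a^2 and b^2 are below d /
       W. *)
    pose W := 4 * (1 + w x y).
    have W0 : 0 < W by rewrite /W mulr_gt0// ltr_pwDl// weight_ge0.
    have dW : 0 < d / W by rewrite divr_gt0.
    apply: filterS2 (sq x _ dW) (sq y _ dW) => n.
    rewrite !ltr_pdivlMr// /W.
    have := weight_ge0 G x y; have := sqr_ge0 (v n x + v n y).
    have := sqr_ge0 (v n x); have := sqr_ge0 (v n y).
    move: (v n x) (v n y) (w x y) => a b c; nra.
have H2 : \forall n \near \oo, (esm (lsq (v n)) < (e / 2)%:E)%E.
  apply: (@esm_dct _ _ (fun n => lsq (v n)) (fun n p => C * lsq (psi n) p) b2) => //.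
  - by move=> n p; rewrite mulr_ge0// ltW.
  - by apply: cvC => // n; exact: lsq_le_nrm.
  - move=> x d d0; have dW : 0 < d / mu x by rewrite divr_gt0// meas_gt0.
    by apply: filterS (sq x _ dW) => n; rewrite ltr_pdivlMr ?meas_gt0.
apply: filterS2 H1 H2 => n h1 h2 /=.
by rewrite (_ : e = e / 2 + e / 2) ?EFinD ?lteD//; lra.
Qed.

(** The energy part and the L^2 part are each bounded by M separately, which is the origin of the
    factor 2. *)
Lemma nrm_fatou (v : nat -> X -> R) u M :
  pw0 (fun n x => u x - v n x) ->
  (\forall n \near \oo, (nrm (v n) <= M%:E)%E) -> (nrm u <= (2 * M)%:E)%E.
Proof.
move=> uv vM.
have cvx x : v ^~ x @ \oo --> u x.
  by apply/cvgrPdist_lt => e e0; exact: uv.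
rewrite (_ : 2 * M = M + M) ?EFinD; last by lra.
apply: leeD.
- apply: (@esm_fatou _ _ (fun n => gsq (v n))) => //.
    move=> [x y] e e0.
    have : (fun n => gsq (v n) (x, y)) @ \oo --> gsq u (x, y).
      rewrite /gsq/=; apply: cvgMr; apply: cvgM; exact: cvgB.
    move=> /cvgrPdist_lt/(_ e e0); apply: filterS => n.
    by rewrite ltr_norml => /andP[_]; rewrite ltrBlDr addrC.
  by apply: filterS vM => n; apply: le_trans; exact: gsq_le_nrm.
- apply: (@esm_fatou _ _ (fun n => lsq (v n))) => //.
    move=> x e e0.
    have : (fun n => lsq (v n) x) @ \oo --> lsq u x.
      by rewrite /lsq/=; apply: cvgMl; apply: cvgM.
    move=> /cvgrPdist_lt/(_ e e0); apply: filterS => n.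
    by rewrite ltr_norml => /andP[_]; rewrite ltrBlDr addrC.
  by apply: filterS vM => n; apply: le_trans; exact: lsq_le_nrm.
Qed.

Lemma real_cauchy (a : nat -> R) :
  (forall e, 0 < e -> exists N, forall m n, (N <= m)%N -> (N <= n)%N ->
     `|a m - a n| < e) -> exists l : R, a @ \oo --> l.
Proof.
move=> H; suff : cvg (a @ \oo) by exists (lim (a @ \oo)).
apply: cauchy_cvg; apply: cauchy_exP => e e0.
have [N NP] := H e e0; exists (a N); exists N => // n /= Nn.
by rewrite -ball_normE/=; apply: NP.
Qed.

(** The limit is the pointwise one. Fatou's lemma, applied to v n - v m as m grows, turns the Cauchy
    estimate e/4 into a bound e/2 on the distance to the limit. *)
Lemma nrm_complete (v : nat -> X -> R) :
  (forall e, 0 < e -> exists N, forall m n, (N <= m)%N -> (N <= n)%N ->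
     (nrm (fun x => v m x - v n x)%R < e%:E)%E) ->
  exists u, forall e, 0 < e -> exists N, forall n, (N <= n)%N ->
     (nrm (fun x => v n x - u x)%R < e%:E)%E.
Proof.
move=> H.
have /choice[u uP] : forall x, exists l : R, v ^~ x @ \oo --> l.
  move=> x; apply: real_cauchy => e e0.
  have [|N NP] := H (e ^+ 2 * mu x); first by rewrite mulr_gt0 ?meas_gt0 ?exprn_gt0.
  exists N => m n mN nN; have := NP _ _ mN nN.
  exact: (@nrm_pw1 (fun x => v m x - v n x)).
exists u => e e0; have e4 : 0 < e / 4 by rewrite divr_gt0.
have [N NP] := H _ e4; exists N => n nN.
apply: (@le_lt_trans _ _ (2 * (e / 4))%:E); last by rewrite lte_fin; lra.
apply: (@nrm_fatou (fun m x => v n x - v m x)).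
  move=> x d d0; have := uP x => /cvgrPdist_lt/(_ d d0); apply: filterS => m.
  have -> : v n x - u x - (v n x - v m x) = - (u x - v m x) by ring.
  by rewrite normrN.
by exists N => // m /= mN; apply: ltW; exact: NP.
Qed.

End GraphForms.

(** * The energy as a bilinear form and Green's formula *)

Lemma psd_formD {R : realType} {V : lmodType R} (D D' : set V)
    (B B' : V -> V -> R) :
  psd_form D B -> psd_form D' B' -> D `<=` D' ->
  psd_form D (fun u v => B u v + B' u v).
Proof.
move=> [D0 Dl Bl Bs B0] [_ _ B'l B's B'0] DD'; split=> //.
- by move=> a u v f Du Dv Df; rewrite Bl// B'l//; try exact: DD'; ring.
- by move=> u v Du Dv; rewrite Bs// B's//; exact: DD'.
- by move=> u Du; rewrite addr_ge0 ?B0 ?B'0//; exact: DD'.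
Qed.

Lemma psd_form_sub {R : realType} {V : lmodType R} (D D' : set V)
    (B : V -> V -> R) :
  D' 0 -> (forall a u v, D' u -> D' v -> D' (a *: u + v)) -> D' `<=` D ->
  psd_form D B -> psd_form D' B.
Proof.
move=> D'0 D'l DD [D0 Dl Bl Bs B0]; split=> //.
- by move=> a u v f Du Dv Df; rewrite Bl//; exact: DD.
- by move=> u v Du Dv; rewrite Bs//; exact: DD.
- by move=> u Du; rewrite B0//; exact: DD.
Qed.

Section BilinearForms.
Context {R : realType} {X : countType} (G : weighted_graph R X).
Implicit Types (u v f phi : X -> R) (e : R).
Local Notation w := (weight G).
Local Notation mu := (meas G).

Let gsq_ge0 := gsq_ge0 G.
Let lsq_ge0 := lsq_ge0 G.
Hint Resolve gsq_ge0 lsq_ge0 : core.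

Definition ebil u v : R :=
  ssum (fun p : X * X =>
    2^-1 * (w p.1 p.2 * ((u p.1 - u p.2) * (v p.1 - v p.2)))).

Lemma innerE u v : inner G u v = ssum (fun x => u x * v x * mu x).
Proof. by []. Qed.

Lemma L2_smb u v : L2 G u -> L2 G v -> smb (fun x => u x * v x * mu x).
Proof.
move=> u2 v2; apply: (@smb_le _ _ _ (fun x => lsq G u x + lsq G v x)).
  move=> x; rewrite /lsq -mulrDl normrM (ger0_norm (meas_ge0 G x)).
  rewrite ler_wpM2r ?meas_ge0// normrM.
  rewrite -(real_normK (num_real (u x))) -(real_normK (num_real (v x))).
  have := sqr_ge0 (`|u x| - `|v x|); nra.
rewrite esmD//; exact: lte_add_pinfty.
Qed.

Lemma L2_lin a u v : L2 G u -> L2 G v -> L2 G (fun x => a * u x + v x).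
Proof.
move=> u2 v2; rewrite /L2/=.
apply: (@le_lt_trans _ _
  (esm (fun x => (2 * a ^+ 2) * lsq G u x + 2 * lsq G v x))).
  apply: le_esm => x; rewrite /lsq !mulrA -mulrDl ler_wpM2r ?meas_ge0//.
  by have := sqr_ge0 (a * u x - v x); nra.
have a0 : 0 <= 2 * a ^+ 2 by rewrite mulr_ge0 ?sqr_ge0.
rewrite esmD//; [|by move=> x; rewrite mulr_ge0..].
by rewrite !esmZ//; apply: lte_add_pinfty; apply: lte_mul_pinfty.
Qed.

Lemma L2_0 : L2 G (0 : X -> R).
Proof.
by rewrite /L2/= /l2sq esum1 ?ltry// => x _; rewrite expr0n/= mul0r.
Qed.

Lemma psd_inner : psd_form (L2 G) (inner G).
Proof.
split.
- exact: L2_0.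
- exact: L2_lin.
- move=> a u v f u2 v2 f2; have s1 := L2_smb u2 f2; have s2 := L2_smb v2 f2.
  rewrite !innerE -(ssumZ a s1) -(ssumD (smbZ a s1) s2).
  apply: eq_ssum => x /=; have -> : (a *: u + v) x = a * u x + v x by [].
  by ring.
- by move=> u v _ _; rewrite !innerE; apply: eq_ssum => x; ring.
- move=> u _; rewrite innerE; apply: ssum_ge0 => x.
  by rewrite -expr2 mulr_ge0 ?sqr_ge0 ?meas_ge0.
Qed.

Lemma gsq_smb u v : (esm (gsq G u) < +oo)%E -> (esm (gsq G v) < +oo)%E ->
  smb (fun p : X * X => w p.1 p.2 * ((u p.1 - u p.2) * (v p.1 - v p.2))).
Proof.
move=> u2 v2; apply: (@smb_le _ _ _ (fun x => gsq G u x + gsq G v x)).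
  move=> [x y]; rewrite /gsq -mulrDr normrM (ger0_norm (weight_ge0 G _ _))/=.
  rewrite ler_wpM2l ?weight_ge0// normrM.
  rewrite -(real_normK (num_real (u x - u y))).
  rewrite -(real_normK (num_real (v x - v y))).
  have := sqr_ge0 (`|u x - u y| - `|v x - v y|); nra.
rewrite esmD//; exact: lte_add_pinfty.
Qed.

Lemma DQmax_gsq u : DQmax G u -> (esm (gsq G u) < +oo)%E.
Proof. by move=> /DQmaxE; apply: le_lt_trans; exact: gsq_le_nrm. Qed.

Lemma DQmax_lin a u v : DQmax G u -> DQmax G v ->
  DQmax G (fun x => a * u x + v x).
Proof.
move=> Du Dv; apply/DQmaxE; rewrite /nrm; apply: lte_add_pinfty; last first.
  by apply: L2_lin; [case: Du|case: Dv].
apply: (@le_lt_trans _ _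
  (esm (fun p => (2 * a ^+ 2) * gsq G u p + 2 * gsq G v p))).
  apply: le_esm => -[x y]; rewrite /gsq/=.
  rewrite (mulrCA _ (w x y)) (mulrCA 2 (w x y)) -mulrDr.
  rewrite ler_wpM2l ?weight_ge0//.
  by have := sqr_ge0 (a * (u x - u y) - (v x - v y)); nra.
have a0 : 0 <= 2 * a ^+ 2 by rewrite mulr_ge0 ?sqr_ge0.
rewrite esmD//; [|by move=> x; rewrite mulr_ge0..].
by rewrite !esmZ//; apply: lte_add_pinfty; apply: lte_mul_pinfty => //;
  exact: DQmax_gsq.
Qed.

Lemma nrm0 : nrm G (0 : X -> R) = 0%E.
Proof.
rewrite /nrm /esm !esum1 ?adde0// => [x|[x y]] _.
  by rewrite /lsq expr0n mul0r.
by rewrite /gsq/= subrr expr0n mulr0.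
Qed.

Lemma DQmax_0 : DQmax G (0 : X -> R).
Proof. by apply/DQmaxE; rewrite nrm0 ltry. Qed.

Lemma psd_ebil : psd_form (DQmax G) ebil.
Proof.
split.
- exact: DQmax_0.
- exact: DQmax_lin.
- move=> a u v f /DQmax_gsq Du /DQmax_gsq Dv /DQmax_gsq Df.
  have s1 := smbZ 2^-1 (gsq_smb Du Df); have s2 := smbZ 2^-1 (gsq_smb Dv Df).
  rewrite /ebil -(ssumZ a s1) -(ssumD (smbZ a s1) s2).
  apply: eq_ssum => -[x y] /=.
  have -> : (a *: u + v) x = a * u x + v x by [].
  have -> : (a *: u + v) y = a * u y + v y by [].
  by ring.
- by move=> u v _ _; apply: eq_ssum => -[x y]; ring.
- move=> u _; apply: ssum_ge0 => -[x y]/=.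
  by rewrite -expr2 mulr_ge0 ?invr_ge0// mulr_ge0 ?weight_ge0 ?sqr_ge0.
Qed.

Definition q1 u v : R := ebil u v + inner G u v.

Lemma psd_q1 : psd_form (DQmax G) q1.
Proof.
by apply: (psd_formD psd_ebil psd_inner) => u [].
Qed.

Lemma ebil_nrm u : (ebil u u = 2^-1 * fine (esm (gsq G u))).
Proof.
rewrite /ebil ssum_ge0E; last first.
  by move=> [x y]/=; rewrite -expr2 mulr_ge0 ?invr_ge0// mulr_ge0 ?weight_ge0 ?sqr_ge0.
have -> : (fun p : X * X => 2^-1 * (w p.1 p.2 * ((u p.1 - u p.2) *
    (u p.1 - u p.2)))) = (fun p => 2^-1 * gsq G u p).
  by apply/funext => p; rewrite /gsq expr2.
rewrite esmZ//; have [fin|] := boolP (esm (gsq G u) \is a fin_num).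
  by rewrite fineM.
by rewrite ge0_fin_numE ?esm_ge0// -leNgt leye_eq => /eqP ->;
  rewrite gt0_muley ?lte_fin//= mulr0.
Qed.

Lemma inner_nrm u : inner G u u = fine (esm (lsq G u)).
Proof.
rewrite innerE ssum_ge0E; last first.
  by move=> x; rewrite -expr2 mulr_ge0 ?sqr_ge0 ?meas_ge0.
by congr fine; apply: eq_esm => x; rewrite expr2.
Qed.

Lemma esm_lsq_fin u : L2 G u -> esm (lsq G u) \is a fin_num.
Proof. by move=> u2; rewrite ge0_fin_numE ?esm_ge0. Qed.

Lemma esm_gsq_fin u : DQmax G u -> esm (gsq G u) \is a fin_num.
Proof. by move=> Du; rewrite ge0_fin_numE ?esm_ge0 ?DQmax_gsq. Qed.

Lemma q1_le_nrm u : DQmax G u -> ((q1 u u)%:E <= nrm G u)%E.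
Proof.
move=> Du; rewrite /q1 ebil_nrm inner_nrm EFinD /nrm; apply: leeD; last first.
  by rewrite fineK// esm_lsq_fin//; case: Du.
rewrite EFinM fineK ?esm_gsq_fin//.
by rewrite -[leRHS]mul1e; apply: lee_wpmul2r; rewrite ?esm_ge0// lee_fin; lra.
Qed.

Lemma nrm_le_q1 u : DQmax G u -> (nrm G u <= (2 * q1 u u)%:E)%E.
Proof.
move=> Du; rewrite /q1 ebil_nrm inner_nrm /nrm.
have gf := esm_gsq_fin Du; have lf := esm_lsq_fin (proj1 Du).
have l0 : (0 <= esm (lsq G u))%E by exact: esm_ge0.
move: l0;  rewrite -(fineK gf) -(fineK lf) -EFinD !lee_fin /=; lra.
Qed.

Lemma energyE u : energy G u = (2^-1%:E * esm (gsq G u))%E.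
Proof. by []. Qed.

Lemma l2sqE u : l2sq G u = esm (lsq G u).
Proof. by []. Qed.

Lemma energy_norm_lt u e : 0 < e ->
  (energy_norm G u < e%:E)%E = (energy G u + l2sq G u < (e ^+ 2)%:E)%E.
Proof.
move=> e0.
have E0 : (0 <= energy G u + l2sq G u)%E.
  by rewrite energyE l2sqE adde_ge0 ?esm_ge0// mule_ge0 ?esm_ge0.
rewrite /energy_norm poweR12_sqrt//; move: E0.
case: (energy G u + l2sq G u)%E => [r| |]//= r0.
by rewrite !lte_fin sqrt_lt.
Qed.

Lemma energy_le_nrm u : (energy G u + l2sq G u <= nrm G u)%E.
Proof.
rewrite energyE l2sqE; apply: leeD => //; rewrite -[leRHS]mul1e.
by apply: lee_wpmul2r; rewrite ?esm_ge0// lee_fin; lra.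
Qed.

Lemma nrm_le_energy u : (nrm G u <= 2%:E * (energy G u + l2sq G u))%E.
Proof.
rewrite energyE l2sqE ge0_muleDr ?mule_ge0 ?esm_ge0//.
apply: leeD; first by rewrite muleA -EFinM mulfV// mul1e.
by rewrite -[leLHS]mul1e; apply: lee_wpmul2r; rewrite ?esm_ge0// lee_fin; lra.
Qed.

Lemma nrm_energy_norm u e : 0 < e -> (nrm G u < (e ^+ 2)%:E)%E ->
  (energy_norm G u < e%:E)%E.
Proof.
by move=> e0; rewrite energy_norm_lt//; apply: le_lt_trans (energy_le_nrm u).
Qed.

Lemma energy_norm_nrm u e : 0 < e -> (energy_norm G u < e%:E)%E ->
  (nrm G u < (2 * e ^+ 2)%:E)%E.
Proof.
move=> e0; rewrite energy_norm_lt// => lt.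
by apply: le_lt_trans (nrm_le_energy u) _; rewrite EFinM lte_pmul2l// lte_fin.
Qed.

Lemma Cc_lin (a : R) u v : Cc u -> Cc v -> Cc (fun x : X => a * u x + v x).
Proof.
move=> Cu Cv; apply: (@sub_finite_set _ _ ([set x | u x != 0] `|` [set x | v x != 0])).
  2: by rewrite finite_setU.
move=> x /=.
have [->|] := eqVneq (u x) 0; last by left.
by rewrite mulr0 add0r; right.
Qed.

Lemma Cc_sub u v : (forall x, v x = 0 -> u x = 0) -> Cc v -> @Cc R X u.
Proof.
move=> uv Cv; apply: sub_finite_set Cv => x /=; apply: contra_neq; exact: uv.
Qed.

Definition delta (x : X) : X -> R := fun y => (y == x)%:R.

Lemma Cc_delta x : Cc (delta x).
Proof.
apply: (@sub_finite_set _ _ [set x]); last exact: finite_set1.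
by move=> y /=; rewrite /delta; have [->|] := eqVneq y x; rewrite ?eqxx.
Qed.

Section LocallyFinite.
Hypothesis lf : locally_finite G.

(** Local finiteness is used here: with F the support of a function phi, the list S contains every
    edge on which phi varies, and both sides of Green's formula become finite sums over S x S. *)
Lemma neighborhood_seq (F : set X) : finite_set F ->
  exists2 S : seq X, uniq S &
    forall x, F x -> x \in S /\ forall y, w x y != 0 -> y \in S.
Proof.
move=> finF.
have fin : finite_set (F `|` \bigcup_(x in F) [set y | adj G x y]).
  by rewrite finite_setU; split=> //; apply: bigcup_finite => // x _; exact: lf.
have [S SE] := (finite_seqP _).1 fin; exists (undup S); first exact: undup_uniq.
move=> x Fx; have inS y : (F `|` \bigcup_(x in F) [set y | adj G x y]) y ->
    y \in undup S by rewrite SE mem_undup.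
split; first by apply: inS; left.
move=> y wxy; apply: inS; right; exists x => //=.
by rewrite /adj lt_neqAle eq_sym wxy weight_ge0.
Qed.

Lemma weight_sym0 x y : (w x y != 0) = (w y x != 0).
Proof. by rewrite weight_sym. Qed.

(** * Green's formula for a finitely supported function *)

Section Green.
Variables (phi : X -> R) (S : seq X).
Hypothesis uS : uniq S.
Hypothesis SP : forall x, phi x != 0 -> x \in S /\ forall y, w x y != 0 -> y \in S.

(** An edge on which phi varies has an end in the support; the other end is a neighbor of it, so
    both lie in S. *)
Lemma edge_off x y : (x \notin S) || (y \notin S) -> w x y * (phi x - phi y) = 0.
Proof.
move=> h; apply: contraTeq h; rewrite mulf_eq0 negb_or => /andP[wxy dphi].
rewrite negb_or !negbK.
have [px|px] := eqVneq (phi x) 0.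
  move: dphi; rewrite px sub0r oppr_eq0 => py.
  by have [-> h] := SP py; rewrite (h x)// -weight_sym0.
by have [-> h] := SP px; rewrite (h y).
Qed.

Lemma laplacian_seq x :
  laplacian G phi x = (mu x)^-1 * \sum_(y <- S) w x y * (phi x - phi y).
Proof.
rewrite /laplacian; congr (_ * _); rewrite [RHS]fsbig_seq//.
apply: esym; apply: fsbig_widen => // y [_ /= /negP yS].
by rewrite edge_off// yS orbT.
Qed.

Lemma laplacian_off x : x \notin S -> laplacian G phi x = 0.
Proof.
move=> xS; rewrite laplacian_seq big1 ?mulr0// => y _.
by rewrite edge_off// xS.
Qed.

Lemma green_swap v :
  \sum_(x <- S) \sum_(y <- S) w x y * (phi x - phi y) * v x =
  \sum_(x <- S) \sum_(y <- S) w x y * phi x * (v x - v y).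
Proof.
have -> : \sum_(x <- S) \sum_(y <- S) w x y * (phi x - phi y) * v x =
    \sum_(x <- S) \sum_(y <- S) (w x y * phi x * v x - w x y * phi y * v x).
  by apply: eq_bigr => x _; apply: eq_bigr => y _; ring.
have -> : \sum_(x <- S) \sum_(y <- S) w x y * phi x * (v x - v y) =
    \sum_(x <- S) \sum_(y <- S) (w x y * phi x * v x - w x y * phi x * v y).
  by apply: eq_bigr => x _; apply: eq_bigr => y _; ring.
under eq_bigr do rewrite sumrB.
under [RHS]eq_bigr do rewrite sumrB.
rewrite !sumrB; congr (_ - _); rewrite exchange_big/=.
by apply: eq_bigr => x _; apply: eq_bigr => y _; rewrite weight_sym.
Qed.

Lemma inner_laplacian_seq v : inner G (laplacian G phi) v =
  \sum_(x <- S) \sum_(y <- S) w x y * phi x * (v x - v y).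
Proof.
rewrite innerE (ssum_seq uS); last by move=> x /laplacian_off ->; rewrite !mul0r.
rewrite -green_swap; apply: eq_bigr => x _; rewrite laplacian_seq.
rewrite -mulr_suml; move: (\sum_(y <- S) _) => s.
by field; rewrite gt_eqF// meas_gt0.
Qed.

Lemma ebil_seq v : ebil phi v =
  \sum_(x <- S) \sum_(y <- S) w x y * phi x * (v x - v y).
Proof.
rewrite /ebil (@ssum_seq _ _ _ [seq (x, y) | x <- S, y <- S]); last 2 first.
- by rewrite allpairs_uniq// => -[x y] [x' y'] _ _.
- move=> [x y] /notin_allpairs/edge_off h; rewrite mulrA h.
  by rewrite mul0r mulr0.
rewrite big_allpairs.
pose a := \sum_(x <- S) \sum_(y <- S) w x y * phi x * (v x - v y).
(* The factor 1/2 of the energy is compensated by the two equal contributions of phi x and phi y,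
   exchanged by the symmetry of w. *)
have aE : \sum_(x <- S) \sum_(y <- S) w x y * phi y * (v y - v x) = a.
  rewrite exchange_big; apply: eq_bigr => x _; apply: eq_bigr => y _.
  by rewrite weight_sym.
rewrite -[RHS]/a (_ : a = 2^-1 * a + 2^-1 * a); last by lra.
rewrite -{2}aE /a !mulr_sumr -big_split; apply: eq_bigr => x _ /=.
rewrite !mulr_sumr -big_split; apply: eq_bigr => y _ /=; ring.
Qed.

End Green.

Lemma ebil_inner phi v : Cc phi -> ebil phi v = inner G (laplacian G phi) v.
Proof.
move=> Cphi; have [S uS SP] := neighborhood_seq Cphi.
by rewrite (ebil_seq uS SP) (inner_laplacian_seq uS SP).
Qed.

Lemma Cc_laplacian phi : Cc phi -> Cc (laplacian G phi).
Proof.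
move=> Cphi; have [S uS SP] := neighborhood_seq Cphi.
apply: (@sub_finite_set _ _ [set` S]); last exact: finite_seq.
move=> x /=; apply: contraR; by move=> /(laplacian_off uS SP) ->.
Qed.

Lemma Cc_L2 u : Cc u -> L2 G u.
Proof.
move=> Cu; have [S uS SP] := neighborhood_seq Cu.
rewrite /L2/= l2sqE (esm_seq (lsq_ge0 u) uS) ?ltry// => x xS.
have [ux|/SP[]] := eqVneq (u x) 0; first by rewrite /lsq ux expr0n mul0r.
by rewrite (negPf xS).
Qed.

Lemma Cc_DQmax u : Cc u -> DQmax G u.
Proof.
move=> Cu; have [S uS SP] := neighborhood_seq Cu.
apply/DQmaxE; rewrite /nrm; apply: lte_add_pinfty; last exact: Cc_L2.
rewrite (@esm_seq _ _ _ [seq (x, y) | x <- S, y <- S]) ?ltry//.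
- by rewrite allpairs_uniq// => -[x y] [x' y'] _ _.
- move=> [x y] /notin_allpairs/(edge_off SP) h.
  by rewrite /gsq/= expr2 mulrA h mul0r.
Qed.

End LocallyFinite.

End BilinearForms.

(** * The forms Q and Q^max *)

Section DirichletForms.
Context {R : realType} {X : countType} (G : weighted_graph R X).
Hypothesis lf : locally_finite G.
Implicit Types (u v f phi : X -> R) (e : R).
Local Notation w := (weight G).
Local Notation mu := (meas G).

Lemma nrm_DQmax u v : (nrm G (fun x => u x - v x)%R < +oo)%E ->
  DQmax G u -> DQmax G v.
Proof.
move=> uv /DQmaxE Du; apply/DQmaxE.
have -> : v = (fun x => u x - (u x - v x)) by apply/funext => x; rewrite subKr.
apply: le_lt_trans (nrmB _ _ _) _; apply: lte_add_pinfty;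
  exact: lte_mul_pinfty.
Qed.

Lemma DQE u : DQ G u <-> DQmax G u /\ forall e, 0 < e ->
  exists2 phi, Cc phi & (nrm G (fun x => u x - phi x)%R < e%:E)%E.
Proof.
split=> -[Du H]; split=> // e e0.
  (* With d <= 1 and d <= e/2, the loss 2 d^2 in passing from [energy_norm] to [nrm] is at most
     e. *)
  have d0 : 0 < Num.min 1 (e / 2) by rewrite lt_min ltr01 divr_gt0.
  have [phi Cphi /(energy_norm_nrm d0) lt] := H _ d0; exists phi => //.
  apply: lt_le_trans lt _; rewrite lee_fin.
  have m1 : Num.min 1 (e / 2) <= 1 by rewrite ge_min lexx.
  have m2 : Num.min 1 (e / 2) <= e / 2 by rewrite ge_min lexx orbT.
  by move: d0 m1 m2; move: (Num.min _ _) => d; nra.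
have e2 : 0 < e ^+ 2 by rewrite exprn_gt0.
by have [phi Cphi lt] := H _ e2; exists phi => //; exact: nrm_energy_norm.
Qed.

Lemma DQ_DQmax u : DQ G u -> DQmax G u.
Proof. by case. Qed.

Lemma Cc_DQ u : Cc u -> DQ G u.
Proof.
move=> Cu; apply/DQE; split; first exact: Cc_DQmax.
move=> e e0; exists u => //.
have -> : (fun x => u x - u x) = (0 : X -> R) by apply/funext => x; rewrite subrr.
by rewrite nrm0 lte_fin.
Qed.

Lemma DQ_seq u : DQ G u ->
  exists phi : nat -> X -> R, (forall n, Cc (phi n)) /\
    cv0 (fun n => nrm G (fun x => u x - phi n x)).
Proof.
move=> /DQE[_ H].
have /choice[phi phiP] : forall n, exists phi, Cc phi /\
    (nrm G (fun x => u x - phi x)%R < (n.+1%:R^-1)%:E)%E.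
  by move=> n; have [|phi] := H n.+1%:R^-1; [rewrite invr_gt0|exists phi].
exists phi; split=> [n|e e0]; first by case: (phiP n).
have [N NP] := natSinv_small e0; exists N => // n /= /NP lt.
by apply: lt_trans (proj2 (phiP n)) _; rewrite lte_fin.
Qed.

Lemma DQ_lim u : DQmax G u ->
  (forall e, 0 < e -> exists2 v, DQ G v & (nrm G (fun x => u x - v x)%R < e%:E)%E) ->
  DQ G u.
Proof.
move=> Du H; apply/DQE; split=> // e e0.
have e4 : 0 < e / 4 by rewrite divr_gt0.
have [v /DQE[_ Dv] uv] := H _ e4; have [phi Cphi vphi] := Dv _ e4.
exists phi => //.
have -> : (fun x => u x - phi x) = (fun x => (u x - v x) + (v x - phi x)).
  by apply/funext => x; ring.
exact: nrm_split.
Qed.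

Lemma DQ_lim_seq u (v : nat -> X -> R) : DQmax G u -> (forall n, DQ G (v n)) ->
  cv0 (fun n => nrm G (fun x => u x - v n x)) -> DQ G u.
Proof.
move=> Du Dv uv; apply: DQ_lim => // e e0.
have [N _ /(_ N (leqnn _)) NP] := uv e e0.
by exists (v N).
Qed.

Lemma DQ_lin a u v : DQ G u -> DQ G v -> DQ G (fun x => a * u x + v x).
Proof.
move=> Du Dv; apply/DQE; split.
  by apply: DQmax_lin; exact: DQ_DQmax.
move=> e e0.
pose K := 2 * a ^+ 2 + 2.
have K0 : 0 < K by rewrite /K ltr_wpDl// mulr_ge0// sqr_ge0.
have eK : 0 < e / K / 4 by rewrite !divr_gt0.
have e4 : 0 < e / 4 / 4 by rewrite !divr_gt0.
have [phi Cphi uphi] := (proj2 ((DQE u).1 Du)) _ eK.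
have [psi Cpsi vpsi] := (proj2 ((DQE v).1 Dv)) _ e4.
exists (fun x => a * phi x + psi x); first exact: Cc_lin.
have -> : (fun x => a * u x + v x - (a * phi x + psi x)) =
   (fun x => (a * (u x - phi x)) + (v x - psi x)).
  by apply/funext => x; ring.
apply: nrm_split => //; last first.
  by apply: lt_trans vpsi _; rewrite lte_fin; lra.
have -> : nrm G (fun x => a * (u x - phi x)) =
    ((a ^+ 2)%:E * nrm G (fun x => u x - phi x)%R)%E.
  rewrite /nrm ge0_muleDr ?esm_ge0//; try exact: gsq_ge0; try exact: lsq_ge0.
  rewrite -!esmZ ?sqr_ge0//; try exact: gsq_ge0; try exact: lsq_ge0.
  congr (_ + _)%E; apply: eq_esm.
    by move=> [x y]; rewrite /gsq/=; ring.
  by move=> x; rewrite /lsq; ring.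
apply: (@le_lt_trans _ _ ((a ^+ 2)%:E * (e / K / 4)%:E)%E).
  by apply: lee_wpmul2l; [rewrite lee_fin sqr_ge0|exact: ltW].
rewrite -EFinM lte_fin !mulrA ltr_pM2r ?invr_gt0// ltr_pdivrMr//.
by rewrite mulrC ltr_pM2l// /K; have := sqr_ge0 a; lra.
Qed.

Lemma Cc_dense_L2 : l2_dense G (@Cc R X).
Proof.
move=> f f2 e e0; have e2 : 0 < e ^+ 2 by rewrite exprn_gt0.
have [s us tl] := esm_tail (lsq_ge0 G f) f2 e2.
exists (fun x => if x \in s then f x else 0).
  apply: (@sub_finite_set _ _ [set` s]); last exact: finite_seq.
  by move=> x /=; case: ifP => //; rewrite eqxx.
set g := (_ \- _); have E : l2sq G g = esm (fun i => if i \in s then 0 else lsq G f i).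
  apply: eq_esm => x; rewrite /g/=; case: ifP => _.
    by rewrite subrr expr0n mul0r.
  by rewrite subr0.
rewrite /l2norm E poweR12_sqrt; last first.
  by apply: esm_ge0 => i; case: ifP => // _; exact: lsq_ge0.
move: tl; set t := esm _; have t0 : (0 <= t)%E.
  by apply: esm_ge0 => i; case: ifP => // _; exact: lsq_ge0.
by case: t t0 => [r| |]//= _; rewrite !lte_fin sqrt_lt.
Qed.

(** * The energy restricted to a domain between C_c(X) and D(Q^max) *)

Section FormOn.
Variable D : set (X -> R).
Hypothesis CcD : @Cc R X `<=` D.
Hypothesis DDQmax : D `<=` DQmax G.
Hypothesis D_lin : forall a u v, D u -> D v -> D (fun x => a * u x + v x).

Lemma Cc_0 : Cc (0 : X -> R).
Proof.
by apply: (@sub_finite_set _ _ set0) => // x /=; rewrite eqxx.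
Qed.

Lemma psd_ebil_on : psd_form D (ebil G).
Proof.
apply: psd_form_sub (psd_ebil G) => //; exact/CcD/Cc_0.
Qed.

Lemma symmetric_form_on : symmetric_form G (Form D (ebil G)).
Proof.
have [_ _ h1 h2 h3] := psd_ebil_on; split=> //=.
- split; last by move=> u /DDQmax[].
  by split=> //; exact/CcD/Cc_0.
- move=> f f2 e e0; have [g Cg lt] := Cc_dense_L2 f2 e0.
  by exists g => //; exact: CcD.
Qed.

Lemma closed_form_on :
  (forall (v : nat -> X -> R) u, (forall n, D (v n)) -> DQmax G u ->
     cv0 (fun n => nrm G (fun x => u x - v n x)) -> D u) ->
  closed_form G (Form D (ebil G)).
Proof.
move=> Dlim u Du cau.
have nE v : form_norm G (Form D (ebil G)) v = Num.sqrt (q1 G v v).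
  by rewrite /form_norm /q1 inner_nrm.
have [|l lP] := @nrm_complete _ _ G u.
  move=> e e0.
  have d0 : 0 < Num.min 1 (e / 2) by rewrite lt_min ltr01 divr_gt0.
  have [N NP] := cau _ d0; exists N => m n mN nN.
  have := NP m n mN nN; rewrite nE sqrt_lt// => lt.
  have Dmn : DQmax G (u m \- u n).
    exact: (psd_DB (psd_ebil G) (DDQmax (Du m)) (DDQmax (Du n))).
  apply: le_lt_trans (nrm_le_q1 Dmn) _; rewrite lte_fin.
  have m1 : Num.min 1 (e / 2) <= 1 by rewrite ge_min lexx.
  have m2 : Num.min 1 (e / 2) <= e / 2 by rewrite ge_min lexx orbT.
  by move: lt d0 m1 m2; move: (Num.min _ _) (q1 _ _ _) => d q; nra.
have Dl : DQmax G l.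
  have [N /(_ N (leqnn _)) NP] := lP 1 ltr01.
  by apply: nrm_DQmax (DDQmax (Du N)); apply: lt_trans NP _; exact: ltry.
exists l.
  apply: (Dlim u) => // e e0; have [N NP] := lP e e0; exists N => // n /= nN.
  have -> : (fun x => l x - u n x) = (fun x => - (u n x - l x)).
    by apply/funext => x; rewrite opprB.
  by rewrite nrmN; exact: NP.
move=> e e0; have e2 : 0 < e ^+ 2 by rewrite exprn_gt0.
have [N NP] := lP _ e2; exists N => n nN.
rewrite nE sqrt_lt// -lte_fin; apply: le_lt_trans (NP n nN).
apply: (@q1_le_nrm _ _ G (u n \- l)).
exact: (psd_DB (psd_ebil G) (DDQmax (Du n)) Dl).
Qed.

End FormOn.

Definition formQ : @form R X := Form (DQ G) (ebil G).
Definition formQmax : @form R X := Form (DQmax G) (ebil G).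

Lemma contraction_DQmax C u : normal_contraction C -> DQmax G u ->
  DQmax G (C \o u) /\ ebil G (C \o u) (C \o u) <= ebil G u u.
Proof.
move=> [C0 Cn] Du.
have DC : DQmax G (C \o u).
  apply/DQmaxE; apply: le_lt_trans ((DQmaxE G u).1 Du).
  by apply: nrm_le => x //=; have := Cn (u x) 0; rewrite C0 !subr0.
split=> //; rewrite !ebil_nrm ler_wpM2l ?invr_ge0//.
apply: fine_le; [exact: esm_gsq_fin|exact: esm_gsq_fin|].
apply: le_esm => -[x y]; rewrite /gsq/= ler_wpM2l ?weight_ge0//.
exact/sqr_le_norm/Cn.
Qed.

(** If phi n in C_c(X) approximates u, then C o phi n is again in C_c(X), because C 0 = 0. The
    increments of C o u - C o phi n are not bounded by those of u - phi n, so convergence comes from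
    domination: with increments U of u and P of phi n, 2 U^2 + 2 P^2 <= 6 U^2 + 4 (U - P)^2. *)
Lemma contraction_DQ C u : normal_contraction C -> DQ G u -> DQ G (C \o u).
Proof.
move=> nC Du; have [C0 Cn] := nC.
have [phi [Cphi phiu]] := DQ_seq Du.
have Dm := DQ_DQmax Du.
apply: (@DQ_lim_seq _ (fun n => C \o phi n)).
- by case: (contraction_DQmax nC Dm).
- move=> n; apply: Cc_DQ; apply: Cc_sub (Cphi n) => x /= ->; exact: C0.
have l0 : (esm (lsq G u) < +oo)%E by case: Dm.
have g0 := DQmax_gsq Dm.
apply: (@nrm_dct _ _ G (fun n x => C (u x) - C (phi n x)) (fun n x => u x - phi n x) 4
  (fun p => 6 * gsq G u p) (fun x => 6 * lsq G u x)) => //.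
- by move=> p; rewrite mulr_ge0 ?gsq_ge0.
- by move=> x; rewrite mulr_ge0 ?lsq_ge0.
- by rewrite esmZ//; [exact: lte_mul_pinfty|exact: gsq_ge0].
- by rewrite esmZ//; [exact: lte_mul_pinfty|exact: lsq_ge0].
- move=> n [x y]; rewrite /gsq/= (mulrCA 6) (mulrCA 4) -mulrDr.
  rewrite ler_wpM2l ?weight_ge0//.
  have := sqr_le_norm (Cn (u x) (u y)).
  have := sqr_le_norm (Cn (phi n x) (phi n y)).
  move: (C (u x)) (C (u y)) (C (phi n x)) (C (phi n y)) => a b c d.
  have := sqr_ge0 ((a - b) + (c - d)).
  move: (u x) (u y) (phi n x) (phi n y) => ux uy px py.
  have := sqr_ge0 ((px - py) - 2 * (ux - uy)).
  nra.
- move=> n x; rewrite /lsq.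
  have := sqr_le_norm (Cn (u x) (phi n x)) => h.
  have m0 := meas_ge0 G x.
  have : (C (u x) - C (phi n x)) ^+ 2 * mu x <= (u x - phi n x) ^+ 2 * mu x.
    by rewrite ler_wpM2r.
  have : 0 <= (u x - phi n x) ^+ 2 * mu x by rewrite mulr_ge0 ?sqr_ge0.
  have : 0 <= u x ^+ 2 * mu x by rewrite mulr_ge0 ?sqr_ge0.
  lra.
- move=> x e e0; apply: filterS (nrm_pw phiu x e0) => n.
  by apply: le_lt_trans; exact: Cn.
Qed.

Lemma dirichlet_formQmax : dirichlet_form G formQmax.
Proof.
have lin := @DQmax_lin _ _ G.
have CcD := Cc_DQmax lf.
split; first exact: symmetric_form_on.
- exact: closed_form_on.
- by move=> C u nC Du; exact: contraction_DQmax.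
Qed.

Lemma dirichlet_formQ : dirichlet_form G formQ.
Proof.
split.
- apply: symmetric_form_on; [exact: Cc_DQ|exact: DQ_DQmax|exact: DQ_lin].
- apply: closed_form_on; [exact: DQ_DQmax|].
  by move=> v u Dv Du; exact: DQ_lim_seq.
- move=> C u nC Du; split; first exact: contraction_DQ.
  by case: (contraction_DQmax nC (DQ_DQmax Du)).
Qed.

End DirichletForms.

(** * Generators *)

Lemma psd_0l {R : realType} {V : lmodType R} (D : set V) (B : V -> V -> R) v :
  psd_form D B -> D v -> B 0 v = 0.
Proof.
move=> psdB Dv; have D0 := psd_D0 psdB.
by have := psd_Bl psdB D0 D0 Dv; rewrite !subrr.
Qed.

Lemma psd_sum {R : realType} {V : lmodType R} (D : set V) (B : V -> V -> R)
    (I : Type) (s : seq I) (c : I -> R) (h : I -> V) :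
  psd_form D B -> (forall i, D (h i)) ->
  D (\sum_(i <- s) c i *: h i) /\
  forall v, D v -> B (\sum_(i <- s) c i *: h i) v = \sum_(i <- s) c i * B (h i) v.
Proof.
move=> psdB Dh; elim: s => [|i s [Ds IH]].
  rewrite big_nil; split; first exact: psd_D0 psdB.
  by move=> v Dv; rewrite big_nil; exact: psd_0l psdB Dv.
rewrite big_cons; split; first exact: psd_Dlin psdB _ _ _ (Dh i) Ds.
by move=> v Dv; rewrite big_cons (psd_lin psdB _ (Dh i) Ds Dv) IH.
Qed.

Section Generators.
Context {R : realType} {X : countType} (G : weighted_graph R X).
Implicit Types (u v f g h phi : X -> R) (e : R).
Local Notation w := (weight G).
Local Notation mu := (meas G).

Lemma lsq_le_inner u x : L2 G u -> u x ^+ 2 * mu x <= inner G u u.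
Proof.
move=> u2; rewrite inner_nrm -lee_fin fineK ?esm_lsq_fin//.
have := @le_sum_esm _ _ (lsq G u) [:: x] (lsq_ge0 G u) isT.
by rewrite big_seq1.
Qed.

Lemma inner_eq0 u : L2 G u -> inner G u u <= 0 -> u = (fun=> 0).
Proof.
move=> u2 u0; apply/funext => x; have := lsq_le_inner x u2 => h.
have : u x ^+ 2 * mu x <= 0 by lra.
rewrite pmulr_lle0 ?meas_gt0// => h2; apply/eqP.
by rewrite -sqrf_eq0 eq_le h2 sqr_ge0.
Qed.

Lemma l2norm_lt u e : 0 < e -> (l2norm G u < e%:E)%E -> inner G u u < e ^+ 2.
Proof.
move=> e0; have l0 : (0 <= esm (lsq G u))%E by exact: esm_ge0 (lsq_ge0 G u).
rewrite /l2norm l2sqE inner_nrm poweR12_sqrt//; move: l0.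
by case: (esm (lsq G u)) => [r| |]//= r0; rewrite lte_fin sqrt_lt.
Qed.

Lemma inner_dense0 (D : set (X -> R)) h : D `<=` L2 G -> l2_dense G D ->
  L2 G h -> (forall v, D v -> inner G h v = 0) -> h = (fun=> 0).
Proof.
move=> DL2 dense h2 h0; apply: inner_eq0 => //.
rewrite leNgt; apply/negP => hh.
(* The tolerance is the norm of h itself: if v is closer than that to h and orthogonal to h, then
   <h, h> = <h, h - v> < <h, h>. *)
have e0 : 0 < Num.sqrt (inner G h h) by rewrite sqrtr_gt0.
have [v Dv /(l2norm_lt e0)] := dense h h2 _ e0.
have v2 := DL2 _ Dv; have psd := psd_inner G.
rewrite sqr_sqrtr ?(ltW hh)// => lt.
have := psd_cs psd h2 (psd_DB psd h2 v2).
rewrite (psd_Br psd h2 v2 h2) (h0 v Dv) subr0 => cs.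
by move: cs lt; rewrite -[inner G (h - v) _]/(inner G (h \- v) (h \- v)); nra.
Qed.

Section Generator.
Variable E : @form R X.
Hypothesis symE : symmetric_form G E.
Hypothesis closedE : closed_form G E.
Local Notation D := (fdom E).

Definition form1 u v : R := fval E u v + inner G u v.

Lemma fdom_L2 : D `<=` L2 G.
Proof. by case: symE => -[]. Qed.

Lemma psd_fval : psd_form D (fval E).
Proof. by case: symE => -[[D0 Dlin] _] _ lin sym pos; split. Qed.

Lemma psd_form1 : psd_form D form1.
Proof. exact: psd_formD psd_fval (psd_inner G) fdom_L2. Qed.

Lemma form_normE u : form_norm G E u = Num.sqrt (form1 u u).
Proof. by rewrite /form_norm /form1 inner_nrm. Qed.

Lemma complete_form1 : complete_on D (fun u v => Num.sqrt (form1 (u - v) (u - v))).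
Proof.
move=> u Du cau; have [] := closedE Du.
  by move=> e /cau[N NP]; exists N => m n mN nN; rewrite form_normE; exact: NP.
move=> l Dl cvl; exists l => // e /cvl[N NP]; exists N => n nN.
by rewrite -[_ - _]/(u n \- l) -form_normE; exact: NP.
Qed.

Lemma inner_le_form1 u : D u -> inner G u u <= form1 u u.
Proof. by move=> Du; rewrite /form1 lerDr; exact: psd_ge0 psd_fval _ Du. Qed.

(** Solves (T + 1) u = g for the generator T, so that T u is g - u: u represents <g, .> in the
    Hilbert space of E_1. *)
Lemma resolvent g : L2 G g -> exists2 u, D u &
  generator G E (u, (fun x => g x - u x)).
Proof.
move=> g2; have psd := psd_inner G.
have [||u Du uP] := riesz psd_form1 (l := inner G g) (C := inner G g g)
    complete_form1.
- move=> a u v /fdom_L2 u2 /fdom_L2 v2; exact: psd_linr psd _ _ _ _ u2 v2 g2.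
- move=> v Dv; apply: le_trans (psd_cs psd g2 (fdom_L2 Dv)) _.
  by apply: ler_wpM2l; [exact: psd_ge0 psd _ g2|exact: inner_le_form1].
have u2 := fdom_L2 Du.
exists u => //; split => //=; first exact: (psd_DB psd g2 u2).
move=> v Dv; have v2 := fdom_L2 Dv; have := uP v Dv; rewrite /form1.
have := psd_Bl psd g2 u2 v2.
by rewrite -[inner G (g - u) v]/(inner G (fun x => g x - u x) v); lra.
Qed.

Lemma generator_sym u f v g : generator G E (u, f) -> generator G E (v, g) ->
  inner G f v = inner G u g.
Proof.
move=> [/= Du f2 uf] [/= Dv g2 vg].
rewrite -uf// (psd_sym psd_fval Du Dv) vg//.
exact: psd_sym (psd_inner G) _ _ g2 (fdom_L2 Du).
Qed.

Lemma generator_linear : linear_operator G (generator G E).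
Proof.
have psd := psd_inner G; have [_ dense _ _ _] := symE.
split.
- by move=> u f [/= Du f2 _]; split=> //; exact: fdom_L2.
- move=> u f g [/= Du f2 uf] [/= _ g2 ug].
  have fg2 := psd_DB psd f2 g2.
  suff : f - g = (fun=> 0).
    by move=> fg; apply/funext => x; apply/eqP; rewrite -subr_eq0;
      have := congr1 (fun k => k x) fg => /= <-.
  apply: (inner_dense0 fdom_L2 dense fg2) => v Dv.
  by rewrite (psd_Bl psd f2 g2 (fdom_L2 Dv)) -uf// -ug// subrr.
- split=> /=; [exact: psd_D0 psd_fval|exact: L2_0|].
  move=> v Dv; rewrite (psd_0l psd_fval Dv).
  by rewrite (psd_0l psd (fdom_L2 Dv)).
- move=> a u f v g [/= Du f2 uf] [/= Dv g2 vg]; split=> /=.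
  + exact: psd_Dlin psd_fval _ _ _ Du Dv.
  + exact: L2_lin.
  + move=> k Dk; have k2 := fdom_L2 Dk.
    have := psd_lin psd_fval a Du Dv Dk; have := psd_lin psd a f2 g2 k2.
    by rewrite uf// vg// => <- ->.
Qed.

(** A symmetric operator T with T + 1 onto is self-adjoint. For (g, k) in the adjoint, solve (T + 1)
    u0 = k + g; then g - u0 is orthogonal to the range of T + 1, hence to itself. *)
Lemma generator_self_adjoint : l2_dense G (op_dom (generator G E)) ->
  self_adjoint G (generator G E).
Proof.
move=> dense; split=> //; first exact: generator_linear.
have psd := psd_inner G.
apply/seteqP; split=> -[g k].
  move=> gk; have [Dg k2 _] := gk; split=> //=; first exact: fdom_L2.
  by move=> u f uf; exact: generator_sym.
move=> [/= g2 k2 adj].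
have kg2 := psd_DD psd k2 g2.
have [u0 Du0 Tu0] := resolvent kg2.
have u02 := fdom_L2 Du0.
have d2 := psd_DB psd g2 u02.
suff d0 : g - u0 = (fun=> 0).
  have gE : g = u0.
    by apply/funext => x; apply/eqP; rewrite -subr_eq0;
      have := congr1 (fun k => k x) d0 => /= <-.
  rewrite gE; congr (generator G E (_, _)): Tu0.
  by apply/funext => x; rewrite gE -[(k + u0) x]/(k x + u0 x) addrK.
apply: inner_eq0 => //.
have [u Du Tu] := resolvent d2; have u2 := fdom_L2 Du.
have h1 := adj _ _ Tu; have h2 := generator_sym Tu Tu0.
have e1 : inner G (g - u0 - u) g = inner G u k by exact: h1.
have e2 : inner G (g - u0 - u) u0 = inner G u (k + g - u0) by exact: h2.
have du2 := psd_DB psd d2 u2.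
have e3 := psd_Br psd g2 u02 du2.
have e4 := psd_Bl psd d2 u2 d2.
have e5 := psd_Br psd kg2 u02 u2.
have e6 := psd_Br psd g2 u02 u2.
have e7 := psd_linr psd 1 k2 g2 u2.
rewrite scale1r in e7.
lra.
Qed.

End Generator.

Hypothesis lf : locally_finite G.

Lemma markovian_generator (D : set (X -> R)) :
  @Cc R X `<=` D -> D `<=` DQmax G -> dirichlet_form G (Form D (ebil G)) ->
  markovian_extension G (generator G (Form D (ebil G))).
Proof.
move=> CcD DD dir; have [sym cl _] := dir.
have LcT : Lc G `<=` generator G (Form D (ebil G)).
  move=> [phi f] [/= Cphi ->]; split=> /=; first exact: CcD.
    by apply: Cc_L2 => //; exact: Cc_laplacian.
  by move=> v _; exact: ebil_inner.
split=> //; last by exists (Form D (ebil G)).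
apply: generator_self_adjoint => //.
move=> f f2 e e0; have [g Cg lt] := Cc_dense_L2 f2 e0.
by exists g => //; exists (laplacian G g); exact: LcT.
Qed.

Lemma markovian_formQ : markovian_extension G (generator G (formQ G)).
Proof.
apply: markovian_generator; [exact: Cc_DQ|exact: DQ_DQmax|].
exact: dirichlet_formQ.
Qed.

Lemma markovian_formQmax : markovian_extension G (generator G (formQmax G)).
Proof.
apply: markovian_generator => //; first exact: Cc_DQmax.
exact: dirichlet_formQmax.
Qed.

(** Let v be the projection of u in D(Q^max) onto D(Q) for [q1], and g = (T + 1)^-1 (u - v). As g
    lies in D(Q), q1(g, u - v) = 0; as T also generates Q^max, the same number is <u - v, u - v>. *)
Lemma eq_generator_DQ : generator G (formQ G) = generator G (formQmax G) ->
  DQ G = DQmax G.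
Proof.
move=> eqT; apply/seteqP; split=> [u|u Du]; first exact: DQ_DQmax.
have [sym cl _] := dirichlet_formQ lf.
have psdq := psd_q1 G; have psd := psd_inner G.
have q1D := psd_form1 sym.
have [||v Dv vP] := riesz q1D (l := q1 G u) (C := q1 G u u)
    (complete_form1 cl).
- move=> a v1 v2 /DQ_DQmax D1 /DQ_DQmax D2.
  exact: psd_linr psdq _ _ _ _ D1 D2 Du.
- by move=> v /DQ_DQmax Dv; exact: psd_cs psdq _ _ Du Dv.
have Dvm := DQ_DQmax Dv.
have Dr := psd_DB psdq Du Dvm.
have r2 : L2 G (u - v) by case: Dr.
have [g Dg] := resolvent sym cl r2; have Dgm := DQ_DQmax Dg.
rewrite eqT => -[/= _ _ /(_ _ Dr) h].
have g2 : L2 G g by case: Dgm.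
have e1 := psd_Bl psd r2 g2 r2.
have e2 := psd_Bl psdq Du Dvm Dgm.
have e3 := vP g Dg.
have e4 := psd_sym psdq Dr Dgm.
have e5 : ebil G g (u - v) = inner G (u - v - g) (u - v) by exact: h.
suff d0 : u - v = (fun=> 0).
  have -> : u = v; last by [].
  by apply/funext => x; apply/eqP; rewrite -subr_eq0;
      have := congr1 (fun k => k x) d0 => /= <-.
apply: inner_eq0 => //.
have e6 : q1 G v g = q1 G u g by exact: e3.
have e7 : q1 G g (u - v) = ebil G g (u - v) + inner G g (u - v) by [].
lra.
Qed.

End Generators.

(** * Uniqueness of Markovian extensions *)

Section Uniqueness.
Context {R : realType} {X : countType} (G : weighted_graph R X).
Implicit Types (u v f g h r phi : X -> R) (e : R).
Local Notation w := (weight G).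
Local Notation mu := (meas G).
Hypothesis lf : locally_finite G.
Variable E : @form R X.
Hypothesis dirE : dirichlet_form G E.
Hypothesis LcE : Lc G `<=` generator G E.
Local Notation D := (fdom E).
Local Notation E1 := (form1 G E).

Let symE : symmetric_form G E. Proof. by case: dirE. Qed.
Let closedE : closed_form G E. Proof. by case: dirE. Qed.
Let psd1 : psd_form D E1 := psd_form1 symE.
Let DL2 : D `<=` L2 G := fdom_L2 symE.

Lemma Cc_fdom phi : Cc phi -> D phi.
Proof. by move=> Cphi; have [] : generator G E (phi, laplacian G phi) by exact: LcE. Qed.

Lemma fval_Cc phi v : Cc phi -> D v -> fval E phi v = inner G (laplacian G phi) v.
Proof.
move=> Cphi Dv; have [_ _ h] : generator G E (phi, laplacian G phi) by exact: LcE.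
exact: h.
Qed.

Lemma form1_pw (a : nat -> X -> R) u : (forall n, D (a n)) -> D u ->
  cvg_seq (fun u v => form_norm G E (u \- v)) a u ->
  forall x e, 0 < e -> \forall n \near \oo, `|a n x - u x| < e.
Proof.
move=> Da Du au x e e0.
have d0 : 0 < Num.sqrt (e ^+ 2 * mu x).
  by rewrite sqrtr_gt0 mulr_gt0 ?meas_gt0 ?exprn_gt0.
have [N NP] := au _ d0; exists N => // n /= nN.
have := NP n nN; rewrite form_normE sqrt_lt// sqr_sqrtr; last first.
  by rewrite mulr_ge0 ?sqr_ge0 ?meas_ge0.
have Dd := psd_DB psd1 (Da n) Du.
have := inner_le_form1 symE Dd => h1.
have := lsq_le_inner x (DL2 Dd) => h2 h3.
have : (a n x - u x) ^+ 2 * mu x < e ^+ 2 * mu x.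
  by apply: le_lt_trans h2 _; apply: le_lt_trans h1 _.
by rewrite ltr_pM2r ?meas_gt0// sqr_lt_norm.
Qed.

(** * E_1-harmonic functions off a finite set F *)

Section Projection.
Variable F : seq X.
Hypothesis uF : uniq F.

Definition vanish : set (X -> R) := [set r | D r /\ forall x, x \in F -> r x = 0].

Lemma psd_vanish : psd_form vanish E1.
Proof.
apply: psd_form_sub psd1.
- by split=> //; exact: psd_D0 psd1.
- move=> a u v [Du u0] [Dv v0]; split; first exact: psd_Dlin psd1 _ _ _ Du Dv.
  move=> x xF; have -> : (a *: u + v) x = a * u x + v x by [].
  by rewrite u0// v0// mulr0 addr0.
- by move=> r [].
Qed.

Lemma complete_vanish :
  complete_on vanish (fun u v => Num.sqrt (E1 (u - v) (u - v))).
Proof.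
move=> u Vu cau; have Du n : D (u n) by case: (Vu n).
have [l Dl cvl] := complete_form1 closedE Du cau.
exists l => //; split=> // x xF; apply/eqP; rewrite -normr_le0.
apply/ler_addgt0Pr => e e0; rewrite add0r.
have cvl' : cvg_seq (fun u v => form_norm G E (u \- v)) u l.
  move=> d /cvl[N NP]; exists N => n nN.
  by rewrite form_normE; exact: NP.
have [N _ /(_ N (leqnn _))] := form1_pw Du Dl cvl' x e0.
by rewrite (proj2 (Vu N))// sub0r normrN => /ltW.
Qed.

Definition harmonic h : Prop := D h /\ forall r, vanish r -> E1 h r = 0.

Lemma projection phi : D phi ->
  exists h, harmonic h /\ forall x, x \in F -> h x = phi x.
Proof.
move=> Dphi.
(* Minus the E_1-projection of phi onto the functions vanishing on F; adding it leaves the values on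
   F unchanged. *)
have [||k [Dk k0] kP] := riesz psd_vanish (l := fun r => - E1 phi r)
    (C := E1 phi phi) complete_vanish.
- move=> a u v [Du _] [Dv _].
  by rewrite (psd_linr psd1 _ Du Dv Dphi); ring.
- by move=> v [Dv _]; rewrite sqrrN; exact: psd_cs psd1 _ _ Dphi Dv.
exists (phi + k); split; last first.
  by move=> x xF; rewrite -[RHS]addr0 -(k0 x xF).
split; first exact: psd_DD psd1 _ _ Dphi Dk.
move=> r Vr; have [Dr _] := Vr.
have := psd_lin psd1 1 Dphi Dk Dr; rewrite scale1r => ->.
by rewrite kP// mul1r subrr.
Qed.

Lemma harmonic_min h g : harmonic h -> D g ->
  (forall x, x \in F -> g x = h x) -> E1 g g <= E1 h h -> g = h.
Proof.
move=> [Dh hP] Dg gh le; have Dd := psd_DB psd1 Dg Dh.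
have Vd : vanish (g - h).
  by split=> // x xF; rewrite -[(g - h) x]/(g x - h x) gh// subrr.
suff d0 : g - h = (fun=> 0).
  by apply/funext => x; apply/eqP; rewrite -subr_eq0;
      have := congr1 (fun k => k x) d0 => /= <-.
apply: inner_eq0; first exact: DL2.
apply: le_trans (inner_le_form1 symE Dd) _.
have := hP _ Vd; rewrite (psd_Br psd1 Dg Dh Dh) => e1.
have := psd_qB psd1 Dg Dh; have := psd_sym psd1 Dg Dh; lra.
Qed.

(** The Markov property enters here: C o h has the same values on F and no larger E_1, and the
    minimizer with given values on F is unique. It is used for the absolute value and for the
    minimum with 1. *)
Lemma harmonic_contraction C h : normal_contraction C -> harmonic h ->
  (forall x, x \in F -> C (h x) = h x) -> C \o h = h.
Proof.
move=> nC hh Ch; have [Dh _] := hh; have [_ _ mark] := dirE.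
have [DC EC] := mark C h nC Dh.
apply: harmonic_min => //; rewrite /form1 lerD//.
rewrite !inner_nrm; apply: fine_le; [exact/esm_lsq_fin/DL2|exact/esm_lsq_fin/DL2|].
apply: le_esm => x; rewrite /lsq ler_wpM2r ?meas_ge0//=; apply: sqr_le_norm.
by have [C0 Cn] := nC; have := Cn (h x) 0; rewrite C0 !subr0.
Qed.

(** Since the generator extends [Lc], pairing with a point mass evaluates the formal operator:
    E_1(delta x, v) = mu(x) (Delta v + v)(x) for every v in D(E), whatever E is. *)
Lemma form1_delta (x : X) : exists2 S, uniq S & (forall z, w x z != 0 -> z \in S) /\
  forall v, D v ->
    E1 (delta x) v = \sum_(z <- S) w x z * (v x - v z) + mu x * v x.
Proof.
have Cx : @Cc R X (delta x) by exact: Cc_delta.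
have [S uS SP] := neighborhood_seq lf Cx.
have dx : delta x x != 0 :> R by rewrite /delta eqxx oner_neq0.
have [xS nS] := SP x dx.
exists S => //; split=> // v Dv.
rewrite /form1 fval_Cc// (inner_laplacian_seq uS SP) innerE.
rewrite (@ssum_seq _ _ _ [:: x])//; last first.
  by move=> y; rewrite inE /delta => /negPf ->; rewrite !mul0r.
rewrite big_seq1 /delta eqxx mul1r (mulrC (v x)); congr (_ + _).
rewrite (bigD1_seq x)//= [X in _ + X]big1 ?addr0.
  by apply: eq_bigr => z _; rewrite eqxx mulr1.
by move=> y /negPf yx; rewrite big1// => z _; rewrite yx mulr0 mul0r.
Qed.

(* In the basis of harmonic functions h_x with h_x = 1_x on F, the matrix of E_1
   has off-diagonal entries at most -w(x, y) because h_x >= 0, and nonnegative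
   row sums because the sum of the h_x is at most 1. *)
Lemma form1_lower_bound u : D u ->
  2^-1 * \sum_(x <- F) \sum_(y <- F) w x y * (u x - u y) ^+ 2 <= E1 u u.
Proof.
move=> Du.
have Ddelta x : D (delta x) by apply/Cc_fdom/Cc_delta.
have /choice[h hP] : forall x, exists h, harmonic h /\
    forall y, y \in F -> h y = delta x y by move=> x; exact: projection.
have hh x : harmonic (h x) by case: (hP x).
have hF x y : y \in F -> h x y = delta x y by case: (hP x) => _; exact.
have Dh x : D (h x) by case: (hh x).
have hhF x : x \in F -> h x x = 1 by move=> xF; rewrite hF// /delta eqxx.
have h_ge0 x z : 0 <= h x z.
  suff <- : Num.norm \o h x = h x by exact: normr_ge0.
  apply: harmonic_contraction (hh x) _.
    by split=> [|s t]; [rewrite normr0|exact: ler_dist_dist].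
  by move=> y yF; rewrite hF// ger0_norm.
have Esum (c : X -> R) : harmonic (\sum_(x <- F) c x *: h x) /\
    forall v, D v -> E1 (\sum_(x <- F) c x *: h x) v =
      \sum_(x <- F) c x * E1 (h x) v.
  have [Ds sP] := psd_sum F c psd1 Dh; split=> //; split=> // r Vr.
  have [Dr _] := Vr; rewrite sP// big1// => x _.
  by rewrite (proj2 (hh x))// mulr0.
have sumF (c : X -> R) y : y \in F -> (\sum_(x <- F) c x *: h x) y = c y.
  move=> yF; rewrite fct_sumE (bigD1_seq y)//= big1 ?addr0.
    by rewrite -[(_ *: _) y]/(c y * h y y) hhF// mulr1.
  move=> x xy; rewrite -[(_ *: _) y]/(c x * h x y) hF// /delta eq_sym (negPf xy).
  by rewrite mulr0.
(* The functions h x and delta x agree on F, so their difference is E_1-orthogonal to harmonic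
   functions. This makes the matrix entries computable by [form1_delta]. *)
have h_delta x g : x \in F -> harmonic g -> E1 (h x) g = E1 (delta x) g.
  move=> xF [Dg gP].
  have V : vanish (h x - delta x).
    split; first exact: psd_DB psd1 _ _ (Dh x) (Ddelta x).
    by move=> y yF; rewrite -[(_ - _) y]/(h x y - delta x y) hF// subrr.
  have := gP _ V; rewrite (psd_Br psd1 (Dh x) (Ddelta x) Dg).
  by rewrite (psd_sym psd1 Dg (Dh x)) (psd_sym psd1 Dg (Ddelta x)); lra.
pose H : X -> R := \sum_(x <- F) 1 *: h x.
have [hH HP] := Esum (fun=> 1); rewrite -/H in hH HP.
have HF y : y \in F -> H y = 1 by move=> yF; rewrite /H (sumF (fun=> 1)).
have H_le1 z : H z <= 1.
  have minC : normal_contraction (fun s : R => Num.min s 1).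
    split=> [|s t]; first by rewrite min_l.
    by rewrite !minEle; case: ifP; case: ifP => h1 h2; rewrite ler_norml;
      have := ler_norm (s - t); have := ler_norm (t - s); rewrite distrC; lra.
  have <- : (fun s : R => Num.min s 1) \o H = H.
    by apply: harmonic_contraction minC hH _ => y /HF ->; rewrite minxx.
  by rewrite /= ge_min lexx orbT.
pose a x y := E1 (h x) (h y).
have aC x y : a x y = a y x by exact: psd_sym psd1 _ _ (Dh x) (Dh y).
have row x : x \in F -> 0 <= \sum_(y <- F) a x y.
  move=> xF; have -> : \sum_(y <- F) a x y = E1 (h x) H.
    rewrite (psd_sym psd1 (Dh x) (proj1 hH)) HP//.
    by apply: eq_bigr => y _; rewrite mul1r aC.
  rewrite h_delta//; have [S uS [_ ->]] := form1_delta x; last by case: hH.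
  rewrite HF// addr_ge0 ?mulr_ge0 ?meas_ge0//.
  by apply: sumr_ge0 => z _; rewrite mulr_ge0 ?weight_ge0 ?subr_ge0.
have off x y : x \in F -> y \in F -> x != y -> w x y <= - a x y.
  move=> xF yF xy; rewrite /a h_delta//.
  have [S uS [nS ->//]] := form1_delta x.
  have hyx : h y x = 0 by rewrite hF// /delta (negPf xy).
  rewrite hyx mulr0 addr0 -sumrN.
  have [yS|/negP yS] := boolP (y \in S); last first.
    have -> : w x y = 0.
      by apply/eqP; apply/negPn/negP => /nS.
    by apply: sumr_ge0 => z _; rewrite sub0r mulrN opprK mulr_ge0 ?weight_ge0.
  rewrite (bigD1_seq y)//= hhF// sub0r mulrN1 opprK lerDl.
  by apply: sumr_ge0 => z _; rewrite sub0r mulrN opprK mulr_ge0 ?weight_ge0.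
pose s : X -> R := \sum_(x <- F) u x *: h x.
have [hs sP] := Esum u; rewrite -/s in hs sP; have [Ds _] := hs.
have Vus : vanish (u - s).
  split; first exact: psd_DB psd1 _ _ Du Ds.
  by move=> x xF; rewrite -[(u - s) x]/(u x - s x) /s sumF// subrr.
(* Pythagoras: s is harmonic and u - s vanishes on F. *)
have Euu : E1 s s <= E1 u u.
  have := proj2 hs _ Vus; rewrite (psd_Br psd1 Du Ds Ds) => e1.
  have := psd_ge0 psd1 (proj1 Vus); rewrite (psd_qB psd1 Du Ds).
  have := psd_sym psd1 Du Ds; lra.
apply: le_trans Euu.
have -> : E1 s s = \sum_(x <- F) \sum_(y <- F) a x y * u x * u y.
  rewrite sP//; apply: eq_bigr => x _.
  rewrite (psd_sym psd1 (Dh x) Ds) sP// mulr_sumr; apply: eq_bigr => y _.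
  by rewrite -[E1 (h y) (h x)]/(a y x) (aC y x); ring.
pose b := \sum_(x <- F) \sum_(y <- F) a x y * u x ^+ 2.
have bE : b = \sum_(x <- F) \sum_(y <- F) a x y * u y ^+ 2.
  rewrite /b exchange_big; apply: eq_bigr => x _; apply: eq_bigr => y _.
  by rewrite aC.
have b0 : 0 <= b.
  rewrite /b big_seq; apply: sumr_ge0 => x xF.
  by rewrite -mulr_suml mulr_ge0 ?sqr_ge0 ?row.
(* From 2 u(x) u(y) = u(x)^2 + u(y)^2 - (u(x) - u(y))^2; b collects the row sums, and the diagonal
   drops out of the last sum. *)
have -> : \sum_(x <- F) \sum_(y <- F) a x y * u x * u y =
    b + 2^-1 * \sum_(x <- F) \sum_(y <- F) - a x y * (u x - u y) ^+ 2.
  rewrite (_ : b = 2^-1 * b + 2^-1 * b); last by lra.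
  rewrite {2}bE /b -!mulrDr -!big_split/= mulr_sumr; apply: eq_bigr => x _.
  by rewrite -!big_split/= mulr_sumr; apply: eq_bigr => y _; field.
rewrite -[leLHS]add0r; apply: lerD => //; rewrite ler_wpM2l ?invr_ge0//.
rewrite big_seq [leRHS]big_seq; apply: ler_sum => x xF.
rewrite big_seq [leRHS]big_seq; apply: ler_sum => y yF.
have [->|xy] := eqVneq x y; first by rewrite subrr expr0n !mulr0.
by rewrite ler_wpM2r ?sqr_ge0// off.
Qed.

End Projection.

Lemma fdom_DQmax : D `<=` DQmax G.
Proof.
move=> u Du; apply/DQmaxE; apply: lte_add_pinfty; last exact: DL2.
apply: (@le_lt_trans _ _ (2 * E1 u u)%:E); last exact: ltry.
apply: esm_pair_le => [|F uF]; first exact: gsq_ge0.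
have := form1_lower_bound uF Du; by rewrite ler_pdivrMl.
Qed.

Lemma form1_Cc phi : Cc phi -> E1 phi phi = q1 G phi phi.
Proof.
move=> Cphi; rewrite /form1 /q1; congr (_ + _).
by rewrite fval_Cc ?ebil_inner//; exact: Cc_fdom.
Qed.

(** On C_c(X) the forms E_1 and [q1] coincide, so approximants of u are also Cauchy for E_1.
    Closedness of E gives a limit, which is u because both convergences are pointwise. *)
Lemma DQ_fdom_seq u : DQ G u -> exists phi : nat -> X -> R,
  [/\ forall n, Cc (phi n), cv0 (fun n => nrm G (fun x => u x - phi n x)), D u &
    cvg_seq (fun u v => form_norm G E (u \- v)) phi u].
Proof.
move=> Du; have [phi [Cphi phiu]] := DQ_seq Du.
exists phi; have Dphi n := Cc_fdom (Cphi n).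
have [l Dl cvl] : exists2 l, D l & cvg_seq (fun u v => form_norm G E (u \- v)) phi l.
  apply: closedE => // e e0.
  have e4 : 0 < e ^+ 2 / 4 by rewrite divr_gt0 ?exprn_gt0.
  have [N _ NP] := phiu _ e4; exists N => m n mN nN.
  rewrite form_normE sqrt_lt//.
  have Cmn : Cc (phi m \- phi n).
    apply: (@Cc_sub _ _ _ (fun x => `|phi m x| + `|phi n x|)).
      move=> x /eqP; rewrite paddr_eq0// !normr_eq0 => /andP[/eqP a /eqP b].
      by rewrite /= a b subrr.
    apply: (@sub_finite_set _ _
        ([set x | phi m x != 0] `|` [set x | phi n x != 0])).
      move=> x /=; have [->|] := eqVneq (phi m x) 0; last by left.
      by rewrite normr0 add0r normr_eq0; right.
    by rewrite finite_setU; split; exact: Cphi.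
  rewrite form1_Cc// -lte_fin.
  apply: le_lt_trans (q1_le_nrm (Cc_DQmax lf Cmn)) _.
  have -> : phi m \- phi n = (fun x => - (u x - phi m x) + (u x - phi n x)).
    by apply/funext => x /=; ring.
  apply: nrm_split; rewrite ?exprn_gt0//; last exact: NP.
  by rewrite nrmN; exact: NP.
have pwl := form1_pw Dphi Dl cvl.
have ul : u = l.
  apply/funext => x; apply/eqP; rewrite -subr_eq0 -normr_le0.
  apply/ler_addgt0Pr => e e0; rewrite add0r.
  have e2 : 0 < e / 2 by rewrite divr_gt0.
  have := @nrm_pw _ _ G (fun n x => u x - phi n x) phiu x _ e2 => h1.
  near \oo => n.
  have a1 : `|u x - phi n x| < e / 2 by near: n.
  have a2 : `|phi n x - l x| < e / 2 by near: n; exact: pwl.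
  have -> : u x - l x = (u x - phi n x) + (phi n x - l x) by ring.
  by apply: le_trans (ler_normD _ _) _; lra.
by rewrite ul; split=> //; rewrite -ul.
Unshelve. all: by end_near.
Qed.

Lemma DQ_fdom : DQ G `<=` D.
Proof. by move=> u /DQ_fdom_seq[phi []]. Qed.

(** Green's formula settles u in C_c(X). With v fixed, both sides are continuous in u along the
    common approximating sequence, by Cauchy-Schwarz. *)
Lemma fval_DQ u v : DQ G u -> DQ G v -> fval E u v = ebil G u v.
Proof.
move=> Qu Qv; have [phi [Cphi phiu Du cvu]] := DQ_fdom_seq Qu.
have Dv := DQ_fdom Qv; have psdE := psd_fval symE; have psde := psd_ebil G.
have Mu := DQ_DQmax Qu; have Mv := DQ_DQmax Qv.
apply/eqP; rewrite -subr_eq0 -sqrf_eq0 eq_le sqr_ge0 andbT.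
apply/ler_addgt0Pr => e e0; rewrite add0r.
pose K := 4 * (1 + fval E v v + ebil G v v).
have v0 := psd_ge0 psdE Dv; have v1 := psd_ge0 psde Mv.
have K0 : 0 < K by rewrite /K; lra.
have eK : 0 < e / K by rewrite divr_gt0.
have d0 : 0 < Num.sqrt (e / K) by rewrite sqrtr_gt0.
have [N1 N1P] := cvu _ d0; have [N2 _ N2P] := phiu _ eK.
pose n := maxn N1 N2.
have Dn := Cc_fdom (Cphi n); have Mn := Cc_DQmax lf (Cphi n).
have Dd := psd_DB psd1 Du Dn; have Md := psd_DB psde Mu Mn.
have lt1 : fval E (u - phi n) (u - phi n) < e / K.
  have := N1P n (leq_maxl _ _); rewrite form_normE sqrt_lt//.
  rewrite sqr_sqrtr ?ltW//; apply: le_lt_trans.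
  have -> : E1 (phi n \- u) (phi n \- u) = E1 (u - phi n) (u - phi n).
    rewrite -[phi n \- u]/(phi n - u) (psd_qB psd1 Du Dn) (psd_qB psd1 Dn Du).
    by rewrite (psd_sym psd1 Du Dn); ring.
  by rewrite /form1 lerDl; exact: psd_ge0 (psd_inner G) _ (DL2 Dd).
have lt2 : ebil G (u - phi n) (u - phi n) < e / K.
  have := N2P n (leq_maxr _ _); rewrite /= -lte_fin; apply: le_lt_trans.
  apply: le_trans (q1_le_nrm Md); rewrite lee_fin /q1 lerDl.
  exact: psd_ge0 (psd_inner G) _ (proj1 Md).
have e1 := psd_Bl psdE Du Dn Dv; have e2 := psd_Bl psde Mu Mn Mv.
have e3 : fval E (phi n) v = ebil G (phi n) v by rewrite fval_Cc ?ebil_inner.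
have -> : fval E u v - ebil G u v = fval E (u - phi n) v - ebil G (u - phi n) v.
  by lra.
have c1 := psd_cs psdE Dd Dv; have c2 := psd_cs psde Md Mv.
have eE : e / K * K = e by rewrite divfK// gt_eqF.
move: c1 c2 lt1 lt2 eE eK v0 v1; rewrite /K.
move: (psd_ge0 psdE Dd) (psd_ge0 psde Md).
move: (fval E (u - _) v) (ebil G (u - _) v) (fval E (u - _) _) (ebil G (u - _) _).
move: (fval E v v) (ebil G v v) (e / _) => A B d x y p q p0 q0 c1 c2 l1 l2 eE dd A0 B0.
have := sqr_ge0 (x + y); have h1 : p * A <= d * A by rewrite ler_wpM2r// ltW.
have h2 : q * B <= d * B by rewrite ler_wpM2r// ltW.
by rewrite -eE; nra.
Qed.

End Uniqueness.

Section Markov.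
Context {R : realType} {X : countType} (G : weighted_graph R X).

Lemma unique_markovian_extension : locally_finite G ->
  (DQ G = DQmax G <-> exists! T, markovian_extension G T).
Proof.
move=> lf; split=> [eqD|[T [_ TP]]]; last first.
  apply: eq_generator_DQ => //.
  rewrite -(TP _ (markovian_formQ lf)); apply: TP; exact: markovian_formQmax.
exists (generator G (formQ G)); split; first exact: markovian_formQ.
(* With D(Q) = D(Q^max), the two inclusions leave no choice for D(E), and [fval_DQ] fixes the
   values. *)
move=> T [LcT _ [E dirE TE]]; rewrite /associated in TE; subst T.
have DE : fdom E = DQ G.
  apply/seteqP; split=> u.
    by rewrite eqD; exact: fdom_DQmax.
  exact: DQ_fdom.
have EE := @fval_DQ _ _ G lf E dirE LcT.
apply/seteqP; split=> -[u f] [/= Du f2 uf]; split=> //=.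
- by rewrite DE.
- by move=> v; rewrite DE => Dv; rewrite EE// uf.
- by rewrite -DE.
- move=> v Qv; have Dv : fdom E v by rewrite DE.
  have Qu : DQ G u by rewrite -DE.
  by rewrite -(EE u v Qu Qv); exact: uf.
Qed.

End Markov.

(** * Polarity of the Cauchy boundary *)

Lemma path_length_cons {R : realType} {X : countType} (s : X -> X -> R) x y p :
  path_length s x (y :: p) = s x y + path_length s y p.
Proof. by rewrite /path_length/= big_cons. Qed.

Lemma path_length_rcons {R : realType} {X : countType} (s : X -> X -> R) x p z :
  path_length s x (rcons p z) = path_length s x p + s (last x p) z.
Proof.
elim: p x => [|y p IH] x; first by rewrite /path_length/= big_cons !big_nil add0r addr0.
by rewrite rcons_cons !path_length_cons IH addrA.
Qed.

Lemma path_length_ge0 {R : realType} {X : countType} (s : X -> X -> R) x p :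
  (forall x y, 0 <= s x y) -> 0 <= path_length s x p.
Proof. by move=> s0; apply: sumr_ge0. Qed.

(** * Walks of bounded length in a locally finite graph *)

Section Walks.
Context {R : realType} {X : countType} (G : weighted_graph R X).
Hypothesis lf : locally_finite G.
Variable s : X -> X -> R.
Hypothesis s_ge0 : forall x y, 0 <= s x y.

(** Asks for a walk, possibly empty, rather than bounding an infimum, so that membership decomposes
    along the first step. *)
Definition walk_ball (x : X) (r : R) : set X :=
  [set y | exists p, [/\ path (adj G) x p, last x p = y & path_length s x p < r]].

Lemma walk_ball_step x r : infinite_set (walk_ball x r) ->
  exists2 z, adj G x z & infinite_set (walk_ball z (r - s x z)).
Proof.
move=> inf; apply: contrapT => H; apply: inf.
apply: (@sub_finite_set _ _ ([set x] `|`
    \bigcup_(z in [set z | adj G x z]) walk_ball z (r - s x z))).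
  move=> y [[|z p] [/= pp <- pl]]; first by left.
  move: pp => /andP[xz pp]; right; exists z => //; exists p; split=> //.
  by move: pl; rewrite path_length_cons; lra.
rewrite finite_setU; split; first exact: finite_set1.
apply: bigcup_finite; first exact: lf.
by move=> z /= xz; apply: contrapT => inf; apply: H; exists z.
Qed.

(** Here t n is the length still available after n steps. The ball of radius t n around u n stays
    infinite, hence nonempty, which forces t n > 0: the infinite walk has finite total length. *)
Lemma infinite_walk x r : infinite_set (walk_ball x r) ->
  exists (u : nat -> X) (t : nat -> R),
    forall n, [/\ adj G (u n) (u n.+1), 0 < t n & t n.+1 = t n - s (u n) (u n.+1)].
Proof.
move=> infxr.
pose T := {q : X * R | infinite_set (walk_ball q.1 q.2)}.
pose rel (a b : T) := adj G (sval a).1 (sval b).1 /\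
  (sval b).2 = (sval a).2 - s (sval a).1 (sval b).1.
have step (a : T) : {b | rel a b}.
  apply: cid; case: a => -[y t] /= inf; have [z yz infz] := walk_ball_step inf.
  by exists (exist _ (z, t - s y z) infz).
have [f [_ fP]] := dependent_choice step (exist _ (x, r) infxr).
exists (fun n => (sval (f n)).1), (fun n => (sval (f n)).2) => n.
have [an tn] := fP n; split=> //.
have := svalP (f n); case: (sval (f n)) => y t /= inf.
rewrite ltNge; apply/negP => t0; apply: inf.
suff -> : walk_ball y t = set0 by [].
rewrite -subset0 => z [p [_ _]].
have := path_length_ge0 y p s_ge0; lra.
Qed.

Variable o : X.

Definition walk_dist (x : X) : R :=
  inf [set path_length s o p | p in [set p | path (adj G) o p /\ last o p = x]].

Let walks x := [set path_length s o p | p in [set p | path (adj G) o p /\ last o p = x]].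

Lemma walks_inf x : has_inf (walks x).
Proof.
split; last by exists 0 => _ [p _ <-]; exact: path_length_ge0.
have [<-|ox] := eqVneq o x; first by exists (path_length s o [::]), [::].
have [p [_ pp lp]] := weight_connected G ox.
by exists (path_length s o p), p.
Qed.

Lemma walk_dist_ge0 x : 0 <= walk_dist x.
Proof.
apply: lb_le_inf; first by case: (walks_inf x).
by move=> _ [p _ <-]; exact: path_length_ge0.
Qed.

Lemma walk_dist_adj x y : adj G x y -> walk_dist y <= walk_dist x + s x y.
Proof.
move=> xy; rewrite -lerBlDr; apply: lb_le_inf; first by case: (walks_inf x).
move=> _ [p [pp lp] <-]; rewrite lerBlDr.
apply: ge_inf; first by case: (walks_inf y).
exists (rcons p y); last by rewrite path_length_rcons lp.
by rewrite /= rcons_path pp lp last_rcons.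
Qed.

Lemma walk_dist_ball r : [set x | walk_dist x < r] `<=` walk_ball o r.
Proof.
move=> x /= xr; have r0 : 0 < r - walk_dist x by rewrite subr_gt0.
have [_ [p [pp lp] <-]] := inf_adherent r0 (walks_inf x).
rewrite -/(walk_dist x) addrC subrK => lt.
by exists p.
Qed.

End Walks.

Section Boundary.
Context {R : realType} {X : countType} (G : weighted_graph R X).
Variables (sigma : X -> X -> R) (Xbar : metricType R) (i : X -> Xbar).
Hypothesis lf : locally_finite G.
Hypothesis edgeS : edge_length G sigma.
Hypothesis intS : strongly_intrinsic G sigma.
Hypothesis compl : is_completion (path_dist G sigma) i.
Implicit Types (u v f phi : X -> R) (e : R).
Local Notation w := (weight G).
Local Notation mu := (meas G).
Local Notation d := (path_dist G sigma).

Let sigma_ge0 x y : 0 <= sigma x y. Proof. by case: edgeS => + _ _; exact. Qed.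
Let sigma_sym x y : sigma x y = sigma y x. Proof. by case: edgeS => _ + _; exact. Qed.
Let sigma_adj x y : adj G x y -> 0 < sigma x y.
Proof. by case: edgeS => _ _ h /h. Qed.

Lemma adj_neq x y : adj G x y -> x != y.
Proof. by apply: contraTneq => ->; rewrite /adj weight_diag ltxx. Qed.

Lemma path_dist_adj x y : adj G x y -> d x y <= sigma x y.
Proof.
move=> xy; rewrite /path_dist (negPf (adj_neq xy)); apply: ge_inf.
  by exists 0 => _ [p _ <-]; exact: path_length_ge0.
exists [:: y]; first by split=> //=; rewrite xy.
by rewrite path_length_cons /path_length/= big_nil addr0.
Qed.

(** Every path leaving x begins with one of finitely many edges, so the smallest of their lengths
    bounds the distance to other vertices from below. *)
Lemma path_dist_isolated x :
  exists2 e, 0 < e & forall y, d x y < e -> y = x.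
Proof.
have [S SE] := (finite_seqP _).1 (lf x).
have SP z : z \in S -> 0 < sigma x z.
  move=> zS; apply: sigma_adj; have : [set` S] z by [].
  by rewrite -SE.
have [e e0 eS] : exists2 e : R, 0 < e & forall z, z \in S -> e <= sigma x z.
  elim: S SP {SE} => [|a S IH] SP; first by exists 1.
  have [|e e0 eS] := IH; first by move=> z zS; apply: SP; rewrite inE zS orbT.
  exists (Num.min e (sigma x a)); first by rewrite lt_min e0 SP ?mem_head.
  move=> z; rewrite inE => /predU1P[->|/eS]; first by rewrite ge_min lexx orbT.
  by move=> h; rewrite ge_min h.
exists e => // y; rewrite /path_dist; case: eqVneq => [//|xy].
move=> lt; exfalso; move: lt; apply/negP; rewrite -leNgt.
apply: lb_le_inf.
  have [p pP] := weight_connected G xy; by exists (path_length sigma x p), p.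
move=> _ [[|z p] [//= _ /andP[xz pp] _] <-]; rewrite path_length_cons.
have zS : z \in S by have : [set y | adj G x y] z by []; rewrite SE.
by apply: le_trans (eS z zS) _; rewrite lerDl path_length_ge0.
Qed.

(** * Functions vanishing on a neighborhood O of the Cauchy boundary *)

Section Neighborhood.
Variable O : set Xbar.
Hypothesis openO : open O.
Hypothesis boundaryO : cauchy_boundary i `<=` O.

Let A (x : X) : bool := `[< ~ O (i x) >].

Let AP x : reflect (~ O (i x)) (A x). Proof. exact: asboolP. Qed.

(* The value on edges meeting O only needs a positive lower bound, so that a
   walk of finite length uses finitely many of them; no comparison with sigma is
   needed there because the functions being cut off vanish on O. *)
Definition cut_length x y : R := if A x && A y then sigma x y else 1.

Lemma cut_length_ge0 x y : 0 <= cut_length x y.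
Proof. by rewrite /cut_length; case: ifP. Qed.

(* An infinite walk of finite length ends up outside O, where it is Cauchy for
   the path metric; its limit is then a vertex, which is an isolated point. *)
Lemma finite_walk_ball x r : finite_set (walk_ball G cut_length x r).
Proof.
apply: contrapT => /(infinite_walk lf cut_length_ge0)[u [t utP]].
have adju n : adj G (u n) (u n.+1) by case: (utP n).
have t0 n : 0 < t n by case: (utP n).
have tS n : t n.+1 = t n - cut_length (u n) (u n.+1) by case: (utP n).
have tdec m n : (m <= n)%N -> t n <= t m.
  move=> /subnKC <-; elim: (n - m)%N => [|k IH]; first by rewrite addn0.
  by rewrite addnS tS; have := cut_length_ge0 (u (m + k)) (u (m + k).+1); lra.
have tcau e : 0 < e -> exists N, forall m n, (N <= m)%N -> (m <= n)%N ->
    t m - t n < e.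
  move=> e0; have infT : has_inf (range t).
    split; first by exists (t 0%N), 0%N.
    by exists 0 => _ [n _ <-]; exact: ltW.
  have [_ [N _ <-] lt] := inf_adherent e0 infT.
  exists N => m n Nm mn.
  have h1 : inf (range t) <= t n by apply: ge_inf; [case: infT|exists n].
  have h2 := tdec _ _ Nm; lra.
have [N1 N1P] := tcau 1 ltr01.
(* An edge meeting O costs 1, while less than 1 is spent after N1. *)
have inA n : (N1 <= n)%N -> A (u n) && A (u n.+1).
  move=> nN; apply/negPn/negP => /negPf h.
  have := N1P n n.+1 nN (leqnSn _); rewrite tS /cut_length h; lra.
have [idist _ icompl] := compl.
have dist_le m n : (N1 <= m)%N -> (m <= n)%N ->
    mdist (i (u m)) (i (u n)) <= t m - t n.
  move=> Nm /subnKC <-; elim: (n - m)%N => [|k IH].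
    by rewrite addn0 mdistxx subrr.
  rewrite addnS; apply: le_trans (metric_triangle _ (i (u (m + k)%N)) _) _.
  have h : mdist (i (u (m + k)%N)) (i (u (m + k).+1)) <=
      cut_length (u (m + k)%N) (u (m + k).+1).
    rewrite /cut_length inA; last by rewrite (leq_trans Nm)// leq_addr.
    by rewrite idist path_dist_adj.
  by rewrite tS; lra.
have [||l _ cvl] := icompl (fun n => i (u n)) => //.
  move=> e e0; have [N2 N2P] := tcau e e0; exists (maxn N1 N2) => m n.
  rewrite !geq_max => /andP[m1 m2] /andP[n1 n2].
  have [mn|/ltnW nm] := leqP m n.
    by apply: le_lt_trans (dist_le _ _ m1 mn) _; exact: N2P.
  by rewrite metric_sym; apply: le_lt_trans (dist_le _ _ n1 nm) _; exact: N2P.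
(* If the limit is a vertex, the walk is eventually constant, although adjacent vertices differ.
   Otherwise the limit is in the open set O, and the walk enters O. *)
have [[a _ al]|] := pselect (range i l).
  have [e e0 eP] := path_dist_isolated a.
  have [N NP] := cvl e e0.
  have ua n : (N <= n)%N -> u n = a.
    by move=> /NP; rewrite -al metric_sym idist; exact: eP.
  have := adju N; rewrite ua// ua; last exact: leqnSn.
  by move/adj_neq; rewrite eqxx.
move=> /boundaryO Ol; have : nbhs l O by apply: open_nbhs_nbhs.
move=> /nbhs_ballP[e /= e0 eO]; have [N NP] := cvl e e0.
have /andP[/AP + _] := inA (maxn N1 N) (leq_maxl _ _); apply; apply: eO.
by rewrite ballEmdist/= metric_sym; apply: NP; exact: leq_maxr.
Qed.

(** The cut-offs 1 - eta n, with eta n = min(1, rho / (n + 1)), have finite support since walk balls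
    are finite. They tend to 1 pointwise, and their increments are bounded independently of n, so
    dominated convergence applies to v eta n. *)
Lemma DQ_vanish_near_boundary v : DQmax G v ->
  (forall x, O (i x) -> v x = 0) -> DQ G v.
Proof.
move=> Dv vO.
have [x0 _] : exists x0 : X, True.
  apply: contrapT => H; apply: (vertices_infinite G).
  suff -> : [set: X] = set0 by [].
  by rewrite -subset0 => x _; apply: H; exists x.
pose rho := walk_dist G cut_length x0.
have rho0 x : 0 <= rho x by exact: walk_dist_ge0 cut_length_ge0 _ _.
pose eta n x := Num.min 1 (rho x / n.+1%:R).
have eta0 n x : 0 <= eta n x by rewrite le_min ler01 divr_ge0.
have eta1 n x : eta n x <= 1 by rewrite ge_min lexx.
have etaL n x y : adj G x y -> eta n x - eta n y <= cut_length x y.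
  move=> xy; have n1 : 1 <= n.+1%:R :> R by rewrite ler1n.
  have n0 : 0 < n.+1%:R :> R by [].
  have yx : adj G y x by rewrite /adj weight_sym.
  have h := walk_dist_adj cut_length_ge0 x0 yx; rewrite -/rho -/(rho _) in h.
  have cs : cut_length y x = cut_length x y.
    by rewrite /cut_length andbC sigma_sym.
  rewrite cs in h; have c0 := cut_length_ge0 x y.
  have h2 : rho x / n.+1%:R <= rho y / n.+1%:R + cut_length x y.
    rewrite ler_pdivrMr// mulrDl divfK ?gt_eqF//.
    apply: le_trans h _; rewrite lerD2l; nra.
  move: h2; rewrite /eta.
  move: (rho x / _) (rho y / _) (cut_length x y) c0 => a b c c0 h2.
  by rewrite !minEle; case: ifP => h3; case: ifP => h4; lra.
pose vn n x := v x * (1 - eta n x).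
apply: (@DQ_lim_seq _ _ _ v vn) => //.
  move=> n; apply: (Cc_DQ lf).
  apply: (@sub_finite_set _ _ [set x | rho x < n.+1%:R]).
    move=> x /=; apply: contraNlt => h; rewrite /vn.
    by rewrite /eta min_l ?subrr ?mulr0// ler_pdivlMr// mul1r.
  apply: sub_finite_set (finite_walk_ball x0 n.+1%:R).
  exact: walk_dist_ball cut_length_ge0 _ _.
(* From v(x) eta(x) - v(y) eta(y) = (v(x) - v(y)) eta(x) + v(y) (eta(x) - eta(y)). Summing the
   second part over x first, the strongly intrinsic bound at y leaves v(y)^2 mu(y). *)
pose b1 (p : X * X) :=
  2 * gsq G v p + 2 * (v p.2 ^+ 2 * (w p.1 p.2 * sigma p.1 p.2 ^+ 2)).
have v20 (p : X * X) : 0 <= v p.2 ^+ 2 * (w p.1 p.2 * sigma p.1 p.2 ^+ 2).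
  by rewrite mulr_ge0 ?sqr_ge0// mulr_ge0 ?weight_ge0 ?sqr_ge0.
have b10 p : 0 <= b1 p by rewrite addr_ge0// mulr_ge0// gsq_ge0.
have sigma_sum x (F : seq X) : uniq F -> \sum_(y <- F) w y x * sigma y x ^+ 2 <= mu x.
  move=> uF; have [_ /(_ x)] := intS.
  have ws0 y : 0 <= w x y * sigma x y ^+ 2 by rewrite mulr_ge0 ?weight_ge0 ?sqr_ge0.
  have := le_sum_esm ws0 uF.
  rewrite /esm; set S := esum _ _ => h1 h2.
  have h3 : ((mu x)^-1%:E * (\sum_(y <- F) w x y * sigma x y ^+ 2)%:E <= 1)%E.
    by apply: le_trans h2; apply: lee_wpmul2l; rewrite ?lee_fin ?invr_ge0 ?meas_ge0.
  move: h3; rewrite -EFinM lee_fin mulrC ler_pdivrMr ?meas_gt0// mul1r.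
  by under eq_bigr do rewrite weight_sym sigma_sym.
have [lsqf gsqf] : (esm (lsq G v) < +oo)%E /\ (esm (gsq G v) < +oo)%E.
  by split; [case: Dv|exact: DQmax_gsq].
have lfin : esm (lsq G v) \is a fin_num by apply: esm_lsq_fin; case: Dv.
have b1f : (esm b1 < +oo)%E.
  rewrite esmD; [|by move=> p; rewrite mulr_ge0 ?gsq_ge0|by move=> p; rewrite mulr_ge0].
  rewrite !esmZ//; last exact: gsq_ge0.
  apply: lte_add_pinfty; apply: lte_mul_pinfty => //.
  apply: (@le_lt_trans _ _ (fine (esm (lsq G v)))%:E); last exact: ltry.
  apply: esm_pair_le => // F uF; rewrite exchange_big/=.
  apply: (@le_trans _ _ (\sum_(y <- F) lsq G v y)).
    apply: ler_sum => y _; rewrite -mulr_sumr /lsq ler_wpM2l ?sqr_ge0//.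
    exact: sigma_sum.
  by rewrite -lee_fin fineK//; apply: le_sum_esm => //; exact: lsq_ge0.
have z0 : cv0 (fun n : nat => nrm G (0 : X -> R)).
  by move=> e e0; apply: nearW => n; rewrite nrm0 lte_fin.
apply: (@nrm_dct _ _ G _ (fun n => 0) 1 b1 (lsq G v)) => //.
- exact: lsq_ge0.
- move=> n [x y]; rewrite -[leLHS]addr0; apply: lerD; last by rewrite mul1r gsq_ge0.
  rewrite /b1 /gsq/= /vn.
  have -> : v x - v x * (1 - eta n x) - (v y - v y * (1 - eta n y)) =
      v x * eta n x - v y * eta n y by ring.
  have [/eqP|w0] := boolP (w x y == 0); first by move=> ->; rewrite !mul0r !mulr0 addr0.
  have xy : adj G x y by rewrite /adj lt_neqAle eq_sym w0 weight_ge0.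
  have yx : adj G y x by rewrite /adj weight_sym.
  rewrite (mulrCA 2 (w x y)) (mulrCA _ (w x y)) (mulrCA 2 (w x y)) -mulrDr.
  rewrite ler_wpM2l ?weight_ge0//.
  have := etaL n x y xy; have := etaL n y x yx; rewrite /cut_length.
  have := eta0 n x; have := eta0 n y; have := eta1 n x; have := eta1 n y.
  rewrite (sigma_sym y x); have := sigma_ge0 x y.
  (* If an end lies in O, then v vanishes there and 0 <= eta <= 1 already gives the bound by the
     increment of v. *)
  have [/AP Ax|/AP/contrapT/vO ->] := boolP (A x); last first.
    move: (eta n y) (v y) (sigma x y) => e b s s0 e1 _ e0 _ _ _.
    have h : e ^+ 2 <= 1 by nra.
    have := sqr_ge0 b; have : 0 <= b ^+ 2 * s ^+ 2 by rewrite mulr_ge0 ?sqr_ge0.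
    by rewrite mul0r !sub0r !sqrrN exprMn; nra.
  have [/AP Ay|/AP/contrapT/vO ->] := boolP (A y); last first.
    move: (eta n x) (v x) (sigma x y) => e b s s0 _ e1 _ e0 _ _.
    have h : e ^+ 2 <= 1 by nra.
    have := sqr_ge0 b.
    by rewrite mul0r !subr0 expr0n/= mul0r mulr0 addr0 exprMn; nra.
  move: (eta n x) (eta n y) (v x) (v y) (sigma x y).
  move=> ex ey a b s s0 ey1 ex1 ey0 ex0 /= h1 h2.
  have hs : (ex - ey) ^+ 2 <= s ^+ 2.
    by apply: sqr_le_norm; rewrite ler_norml (ger0_norm s0); lra.
  have hx : ex ^+ 2 <= 1 by nra.
  have -> : a * ex - b * ey = (a - b) * ex + b * (ex - ey) by ring.
  have k1 : ((a - b) * ex) ^+ 2 <= (a - b) ^+ 2.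
    by rewrite exprMn; have := sqr_ge0 (a - b); nra.
  have k2 : (b * (ex - ey)) ^+ 2 <= b ^+ 2 * s ^+ 2.
    by rewrite exprMn ler_wpM2l ?sqr_ge0.
  by apply: le_trans (sqrD_le _ _) _; lra.
- move=> n x; rewrite -[leLHS]addr0; apply: lerD; last by rewrite mul1r lsq_ge0.
  rewrite /lsq /vn ler_wpM2r ?meas_ge0//; apply: sqr_le_norm.
  rewrite (_ : _ - _ = v x * eta n x); last by ring.
  by rewrite normrM (ger0_norm (eta0 n x)) ler_piMr.
- move=> x e e0; have K0 : 0 < e / (1 + `|v x| * rho x + 1).
    by rewrite divr_gt0// addr_gt0// ltr_pwDl// mulr_ge0.
  have [N NP] := natSinv_small K0; exists N => // n /= /NP lt.
  rewrite /vn (_ : _ - _ = v x * eta n x); last by ring.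
  rewrite normrM (ger0_norm (eta0 _ _)).
  apply: (@le_lt_trans _ _ (`|v x| * (rho x / n.+1%:R))).
    by rewrite ler_wpM2l// ge_min lexx orbT.
  rewrite mulrA; move: lt; rewrite ltr_pdivlMr; last first.
    by rewrite addr_gt0// ltr_pwDl// mulr_ge0.
  have : 0 < (n.+1%:R^-1 : R) by rewrite invr_gt0.
  have : 0 <= `|v x| * rho x by rewrite mulr_ge0.
  by move: (`|v x| * rho x) (n.+1%:R^-1) => a b a0 b0; nra.
Qed.

End Neighborhood.

Lemma energy_norm_ge0 u : (0 <= energy_norm G u)%E.
Proof. exact: poweR_ge0. Qed.

Lemma cap_completion_ge0 B : (0 <= cap_completion G i B)%E.
Proof.
apply: le_ereal_inf_tmp => _ [ O _ <-]; apply: le_ereal_inf_tmp => _ [u _ <-].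
exact: energy_norm_ge0.
Qed.

(** Replacing an admissible u by min(|u|, 1) does not raise the norm, and makes the potential
    exactly 1 on O, so that 1 - g vanishes there. *)
Lemma polar_seq : polar_boundary G i ->
  forall e, 0 < e -> exists (O : set Xbar) (g : X -> R),
    [/\ open O, cauchy_boundary i `<=` O, DQmax G g, (nrm G g < e%:E)%E &
      (forall x, 0 <= g x <= 1) /\ forall x, O (i x) -> g x = 1].
Proof.
move=> pol e e0; pose dd := Num.min 1 (e / 2).
have d0 : 0 < dd by rewrite lt_min ltr01 divr_gt0.
have : (cap_completion G i (cauchy_boundary i) < dd%:E)%E by rewrite pol lte_fin.
move=> /ereal_inf_lt[_ [ O [bO oO] <-]] /ereal_inf_lt[_ [u [Du uO] <-]] lt.
exists O, (fun x => Num.min `|u x| 1).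
have nrmle : (nrm G (fun x => Num.min `|u x| 1)%R <= nrm G u)%E.
  apply: nrm_le => [x|x y].
    by rewrite ger0_norm ?ge_min ?lexx// le_min normr_ge0 ler01.
  apply: le_trans (ler_dist_dist _ _); rewrite ler_norml.
  have := ler_norm (`|u x| - `|u y|); have := ler_norm (- (`|u x| - `|u y|)).
  by rewrite normrN !minEle; case: ifP; case: ifP; lra.
split=> //.
- by apply/DQmaxE; apply: le_lt_trans nrmle _; exact/DQmaxE.
- apply: le_lt_trans nrmle _; apply: lt_le_trans (energy_norm_nrm d0 lt) _.
  rewrite lee_fin; have m1 : dd <= 1 by rewrite ge_min lexx.
  have m2 : dd <= e / 2 by rewrite ge_min lexx orbT.
  by clear lt; move: d0 m1 m2; move: dd => d; nra.
- split=> x; first by rewrite le_min normr_ge0 ler01 ge_min lexx orbT.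
  move=> Ox; rewrite min_r//; apply: le_trans (ler_norm _).
  by have := uO x; rewrite indicE mem_set.
Qed.

Lemma polar_bounded_DQ u (M : R) : polar_boundary G i -> DQmax G u ->
  (forall x, `|u x| <= M) -> DQ G u.
Proof.
move=> pol Du uM.
have /choice[Og OgP] : forall n : nat, exists Og : set Xbar * (X -> R),
   [/\ open Og.1, cauchy_boundary i `<=` Og.1, DQmax G Og.2,
       (nrm G Og.2 < (n.+1%:R^-1)%:E)%E &
      (forall x, 0 <= Og.2 x <= 1) /\ forall x, Og.1 (i x) -> Og.2 x = 1].
  move=> n; have [|O [g H]] := polar_seq pol (e := n.+1%:R^-1).
    by rewrite invr_gt0.
  by exists (O, g).
pose g n := (Og n).2.
have g0 : cv0 (fun n => nrm G (g n)).
  move=> e e0; have [N NP] := natSinv_small e0; exists N => // n /= /NP lt.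
  have [_ _ _ h _] := OgP n; apply: lt_trans h _; by rewrite lte_fin.
have g01 n x : 0 <= g n x <= 1 by case: (OgP n) => _ _ _ _ [+ _]; exact.
have uM2 x : u x ^+ 2 <= M ^+ 2.
  by apply: sqr_le_norm; apply: le_trans (uM x) (ler_norm _).
have conv : cv0 (fun n => nrm G (fun x => u x - u x * (1 - g n x))).
  (* The difference is u g n. Its increments split into (u(x) - u(y)) g(x), dominated by those of u,
     and u(y) (g(x) - g(y)), at most M times those of g n; the summand 1 keeps the constant
     positive. *)
  apply: (@nrm_dct _ _ G _ g (2 * M ^+ 2 + 1) (fun p => 2 * gsq G u p) (fun=> 0)) => //.
  - by have := sqr_ge0 M; lra.
  - by move=> p; rewrite mulr_ge0// gsq_ge0.
  - by rewrite esmZ//; [apply: lte_mul_pinfty => //; exact: DQmax_gsq|exact: gsq_ge0].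
  - by rewrite /esm esum1 ?ltry.
  - move=> n [x y]; rewrite /gsq/=.
    rewrite (mulrCA 2 (w x y)) (mulrCA _ (w x y)) -mulrDr ler_wpM2l ?weight_ge0//.
    have /andP[a0 a1] := g01 n x; have := uM2 y; move: a0 a1.
    move: (g n x) (g n y) (u x) (u y) => a b p q a0 a1 qM.
    have -> : p - p * (1 - a) - (q - q * (1 - b)) = (p - q) * a + q * (a - b) by ring.
    have k1 : ((p - q) * a) ^+ 2 <= (p - q) ^+ 2.
      have a2 : a ^+ 2 <= 1 by nra.
      by rewrite exprMn ler_piMr ?sqr_ge0.
    have k2 : (q * (a - b)) ^+ 2 <= M ^+ 2 * (a - b) ^+ 2.
      by rewrite exprMn ler_wpM2r ?sqr_ge0.
    by apply: le_trans (sqrD_le _ _) _; have := sqr_ge0 (a - b); lra.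
  - move=> n x; rewrite add0r /lsq mulrA ler_wpM2r ?meas_ge0//.
    rewrite (_ : _ - _ = u x * g n x); last by ring.
    by rewrite exprMn; have := uM2 x; have := sqr_ge0 (g n x); have := sqr_ge0 M; nra.
  - move=> x e e0; have M0 : 0 < 1 + M.
      by rewrite ltr_pwDl//; apply: le_trans (uM x).
    have eM : 0 < e / (1 + M) by rewrite divr_gt0.
    apply: filterS (nrm_pw g0 x eM) => n; rewrite ltr_pdivlMr// => lt.
    rewrite (_ : _ - _ = u x * g n x); last by ring.
    rewrite normrM; apply: le_lt_trans lt; rewrite mulrC ler_wpM2l//.
    by apply: le_trans (uM x) _; rewrite lerDr.
apply: (DQ_lim Du) => e e0; have [N _ /(_ N (leqnn _)) NP] := conv e e0.
exists (fun x => u x * (1 - g N x)) => //.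
have [oO bO _ _ [_ gO]] := OgP N.
apply: (DQ_vanish_near_boundary oO bO).
  by apply: nrm_DQmax Du; apply: lt_trans NP _; exact: ltry.
by move=> x /gO; rewrite -/(g N) => ->; rewrite subrr mulr0.
Qed.

Lemma polar_DQ : polar_boundary G i -> DQ G = DQmax G.
Proof.
move=> pol; apply/seteqP; split=> [u|u Du]; first exact: DQ_DQmax.
pose c (n : nat) (t : R) := Num.max (- n%:R) (Num.min t n%:R).
have nC n : normal_contraction (c n).
  have n0 : 0 <= n%:R :> R by [].
  split; first by rewrite /c min_l// max_r// oppr_le0.
  move=> s t; rewrite /c; move: (n%:R : R) n0 => N N0; rewrite ler_norml.
  have := ler_norm (s - t); have := ler_norm (- (s - t)); rewrite normrN.
  by rewrite !minEle !maxEle; do 4 case: ifP; lra.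
apply: (@DQ_lim_seq _ _ _ u (fun n => c n \o u)) => //.
  move=> n; apply: (@polar_bounded_DQ _ n%:R) => //.
    by case: (contraction_DQmax (nC n) Du).
  move=> x; have n0 : 0 <= n%:R :> R by [].
  rewrite /= /c; move: (n%:R : R) n0 => N N0; rewrite ler_norml.
  by rewrite !minEle !maxEle; do 2 case: ifP; lra.
have z0 : cv0 (fun n : nat => nrm G (0 : X -> R)).
  by move=> e e0; apply: nearW => n; rewrite nrm0 lte_fin.
(* The remainder of the truncation is a contraction too, so u itself dominates u - c n o u. *)
have cS n s t : `|(s - c n s) - (t - c n t)| <= `|s - t|.
  have n0 : 0 <= n%:R :> R by [].
  rewrite /c; move: (n%:R : R) n0 => N N0; rewrite ler_norml.
  have := ler_norm (s - t); have := ler_norm (- (s - t)); rewrite normrN.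
  by rewrite !minEle !maxEle; do 4 case: ifP; lra.
have cc0 n : c n 0 = 0 by case: (nC n).
apply: (@nrm_dct _ _ G _ (fun n => 0) 1 (gsq G u) (lsq G u)) => //.
- exact: gsq_ge0.
- exact: lsq_ge0.
- exact: DQmax_gsq.
- by case: Du.
- move=> n p; rewrite -[leLHS]addr0; apply: lerD; last by rewrite mul1r gsq_ge0.
  rewrite /gsq ler_wpM2l ?weight_ge0//; apply: sqr_le_norm; exact: cS.
- move=> n x; rewrite -[leLHS]addr0; apply: lerD; last by rewrite mul1r lsq_ge0.
  rewrite /lsq ler_wpM2r ?meas_ge0//; apply: sqr_le_norm.
  by have := cS n (u x) 0; rewrite cc0 !subr0.
- move=> x e e0; exists (Num.truncn `|u x|).+1 => // n /= nN.
  have : `|u x| <= n%:R.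
    apply: le_trans (ltW (truncnS_gt _)) _; by rewrite ler_nat.
  rewrite ler_norml => /andP[h1 h2].
  by rewrite /c min_l// max_r// subrr normr0.
Qed.

Lemma finite_image_closed (s : seq X) : closed (i @` [set` s]).
Proof.
apply: (accessible_finite_set_closed.1 (hausdorff_accessible (@metric_hausdorff _ Xbar))).
by apply: finite_image; exact: finite_seq.
Qed.

Lemma DQ_polar : (cap_completion G i (cauchy_boundary i) < +oo)%E ->
  DQ G = DQmax G -> polar_boundary G i.
Proof.
move=> /ereal_inf_lt[_ [ O [bO oO] <-]] /ereal_inf_lt[_ [u [Du uO] <-]] _ eqD.
apply/eqP; rewrite /polar_boundary eq_le cap_completion_ge0 andbT.
apply/lee_addgt0Pr => e e0; rewrite add0e.
have : DQ G u by rewrite eqD.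
move=> /DQE[_ uc]; have [phi Cphi lt] := uc _ (exprn_gt0 2 e0).
have [s sE] := (finite_seqP _).1 Cphi.
(* The absolute value makes g nonnegative off the neighborhood, as admissibility for [cap] demands,
   without raising the norm. *)
pose g x := `|u x - phi x|.
have gle : (nrm G g <= nrm G (fun x => u x - phi x)%R)%E.
  apply: nrm_le => [x|x y]; first by rewrite /g normr_id.
  exact: ler_dist_dist.
have gn := le_lt_trans gle lt.
apply: (@le_trans _ _ (energy_norm G g)); last exact: ltW (nrm_energy_norm e0 gn).
(* Removing the support of phi keeps the set open, and it still contains the boundary, since the
   removed points are vertices. *)
apply: (@le_trans _ _ (cap G (i @^-1` (O `&` ~` (i @` [set` s]))))).
  apply: ereal_inf_lbound; exists (O `&` ~` (i @` [set` s])) => //; split.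
    move=> l bl; split; first exact: bO.
    by move=> [x _ xl]; apply: bl; exists x.
  apply: openI => //; rewrite openC; exact: finite_image_closed.
apply: ereal_inf_lbound; exists g => //; split.
  by apply/DQmaxE; apply: lt_trans gn _; exact: ltry.
move=> x; rewrite indicE; case: (boolP (x \in _)) => [|_]; last by rewrite normr_ge0.
rewrite inE => -[Ox nx].
have phix : phi x = 0.
  apply/eqP/negPn/negP => px; apply: nx; exists x => //.
  by rewrite -sE.
rewrite /g phix subr0; apply: le_trans (ler_norm _).
by have := uO x; rewrite indicE mem_set.
Qed.

End Boundary.

Theorem theorem3 (R : realType) (X : countType) (G : weighted_graph R X)
    (sigma : X -> X -> R) (Xbar : metricType R) (i : X -> Xbar) :
  locally_finite G ->
  edge_length G sigma ->
  strongly_intrinsic G sigma ->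
  ~ metrically_complete (path_dist G sigma) ->
  is_completion (path_dist G sigma) i ->
  (cap_completion G i (cauchy_boundary i) < +oo)%E ->
  (polar_boundary G i <-> DQ G = DQmax G) /\
  (DQ G = DQmax G <-> exists! T, markovian_extension G T).
Proof.
move=> lf edgeS intS _ compl capfin; split; last exact: unique_markovian_extension.
split; first exact: polar_DQ lf edgeS intS compl.
exact: DQ_polar.
Qed.
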